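(* In the Martin setting described in the context, assume that $\mathscr H_1(Ax_0)$ is a metrizable Choquet simplex. For $q\in\mathscr H_1(Ax_0)$ let $\nu_q$ be the unique regular Borel probability measure on $S_\varphi(Ax_0)$ concentrated on $\partial_m^{\mathrm{np}}(Ax_0)$ with $\operatorname{Ev}^q(a)=\int\operatorname{Ev}^{\mathfrak h(p)}(a)\,\mathrm d\nu_q(p)$ for every $a\in Ax_0$. Then every $q\in\mathscr H_1(Ax_0)$ admits a probability measure $\mu$ on $S_1(Ax_0)$ such that $(r_\varphi)_*\mu=\nu_q$; equivalently, $\int F\circ r_\varphi\,\mathrm d\mu=\int F\,\mathrm d\nu_q$ for every $F\in C(S_\varphi(Ax_0))$. The entire fiber $$\operatorname{Lift}(\nu_q)=\{\mu\in\mathcal P(S_1(Ax_0)):(r_\varphi)_*\mu=\nu_q\}$$ is a nonempty compact convex subset of $\mathcal P(S_1(Ax_0))$.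
   Context: $(X,\tau)$ is a nonempty, locally compact, locally connected Hausdorff space with a sheaf $H$ of continuous real functions (harmonic functions, $H(U)$ a linear space) forming a Brelot harmonic space: there is a base $\tau_0$ of relatively compact regular open sets (regular: every $g\in C(\partial U)$ has a unique harmonic extension with boundary values $g$, nonnegative if $g\ge0$), and increasing sequences of harmonic functions on a connected $U\in\tau_0$ have supremum harmonic or $\equiv+\infty$. $\mathfrak M$ is the corresponding structure in the many-sorted continuous language $\mathcal L_{\mathrm{Har}}$, which has a metric point sort $X$ and, for $U\in\tau_0$, metric sorts for $U$, for $H(U)$ and for boundary functions, with symbols for inclusions, restrictions, the Dirichlet operator and evaluation. $U\in\tau_0$ is a Greenian regular domain with Green kernel $G_U$; $x_0\in U$, $U^\times=U\setminus\{x_0\}$; $K_U(x,y)=G_U(x,y)/G_U(x_0,y)$ for $y\in U^\times$. Fix a continuous strictly increasing $\beta:[0,\infty]\to[0,1]$, $\beta(\infty)=1$, and put $\varphi(y;x)=\varphi_U(y;x)=\beta(K_U(x,y))$, assumed to extend uniformly continuously across the diagonal. $\operatorname{Prof}_U(y)$ is $x\mapsto\varphi(y;x)$; $\widehat U^M$ is the closure of $\{\operatorname{Prof}_U(y):y\in U^\times\}$ in $C(U,[0,1])$ (compact-open topology). It is assumed that $y\mapsto\operatorname{Prof}_U(y)$ extends over $x_0$, embeds $U$ densely in $\widehat U^M$ and separates boundary profiles, and that profiles separate points of $U$; $\partial_MU=\widehat U^M\setminus U$. For $\xi\in\partial_MU$, $k_\xi$ is the unique positive harmonic function on $U$ with $k_\xi(x_0)=1$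 and $\operatorname{Prof}_U(\xi)(x)=\beta(k_\xi(x))$ for all $x\in U$. $A\subseteq U$ is dense with $|A|$ equal to the density character of $U$, $Ax_0=A\cup\{x_0\}$. The language is $\mathcal L_{\mathrm{Har}}\cup\{x_0,\varphi_U\}$ in its $Ax_0$-definitional expansion. $S_1(Ax_0)$ is the compact Hausdorff space of complete $1$-types over $Ax_0$ in a point variable $y$; $S_\varphi(Ax_0)$ is the space of local $\varphi$-types over $Ax_0$ (recording the values $\varphi^p(a)$ of $\varphi(y;a)$, $a\in Ax_0$, consistently with $\operatorname{Th}_{Ax_0}(\mathfrak M)$), with the weakest topology making all $p\mapsto\varphi^p(a)$ continuous; $r_\varphi:S_1(Ax_0)\to S_\varphi(Ax_0)$, $p\mapsto p\upharpoonright\varphi$, is the restriction map. $C_\varphi(Ax_0)$ is the closure of $\{\operatorname{tp}_\varphi(y/Ax_0):y\in U^\times\}$. A type $p$ is principal if there are a formula $\psi(\bar y)$ and terms $\bar t(\bar y)$ over $Ax_0$ and rational $r>0$ such that $\operatorname{Th}_{Ax_0}(\mathfrak M)\cup\{\psi=0\}$ is satisfiable and in every model of $\operatorname{Th}_{Ax_0}(\mathfrak M)$, $\psi(\bar b)\le r$ implies $\bar t(\bar b)\models p$. $\partial_M^{\mathrm{np}}(Ax_0)$ is the set of non-principal members of $C_\varphi(Ax_0)$. The map $\Gamma:\widehat U^M\to C_\varphi(Ax_0)$ sending $\xi$ to the type with values $\operatorname{Prof}_U(\xi)(a)$ is a homeomorphism restricting to a homeomorphism $\partial_MU\to\partial_M^{\mathrm{np}}(Ax_0)$.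 $H^+(U)$ is the set of nonnegative harmonic functions on $U$; $\operatorname{tp}_{\operatorname{Ev}}(h/Ax_0)$ is the record of the values $h(a)$, $a\in Ax_0$; $\operatorname{Ev}^q(a)$ is the value of $q$ at $a$; $\mathscr H_1(Ax_0)=\{\operatorname{tp}_{\operatorname{Ev}}(h/Ax_0):h\in H^+(U),h(x_0)=1\}$ with pointwise convex structure and the topology generated by $q\mapsto\operatorname{Ev}^q(a)$, $a\in Ax_0$ (it is compact convex). For $p\in\partial_M^{\mathrm{np}}(Ax_0)$, $k_p=k_{\Gamma^{-1}(p)}$ and $\mathfrak h(p)=\operatorname{tp}_{\operatorname{Ev}}(k_p/Ax_0)$; $\partial_m^{\mathrm{np}}(Ax_0)=\mathfrak h^{-1}(\operatorname{Ext}(\mathscr H_1(Ax_0)))$, $\operatorname{Ext}$ denoting extreme points. $\mathcal P(Y)$ is the space of regular Borel probability measures on a compact Hausdorff space $Y$ with the weak-$*$ topology. *)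

(* Defs.v *)
From HB Require Import structures.
From mathcomp Require Import all_boot all_order all_algebra.
From mathcomp Require Import all_classical all_reals all_analysis.
From mathcomp Require Import lra.

Set Implicit Arguments.
Unset Strict Implicit.
Unset Printing Implicit Defensive.

Import Order.TTheory GRing.Theory Num.Theory numFieldNormedType.Exports.

Local Open Scope classical_set_scope.
Local Open Scope ring_scope.

Definition is_metric (R : realType) (T : Type) (d : T -> T -> R) : Prop :=
  [/\ forall x y, 0 <= d x y,
      forall x y, d x y = 0 <-> x = y,
      forall x y, d x y = d y x &
      forall x y z, d x z <= d x y + d y z].

Definition is_unit_metric (R : realType) (T : Type) (d : T -> T -> R) : Prop :=
  is_metric d /\ forall x y, d x y <= 1.

Definition metric_induces (R : realType) (T : topologicalType)
    (d : T -> T -> R) : Prop :=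
  forall (x : T) (A : set T),
    nbhs x A <-> exists2 e : R, 0 < e & [set y | d x y < e] `<=` A.

Definition metrizable_set (R : realType) (T : topologicalType) (A : set T)
    : Prop :=
  exists d : A -> A -> R, is_metric d /\ metric_induces d.

(* Variables are intrinsically typed de Bruijn indices: a context is the list
   of the sorts of the free variables, and the quantified variable is the head
   of the context. *)

Inductive var (S : Type) : seq S -> S -> Type :=
| VHere (s : S) (c : seq S) : var (s :: c) s
| VThere (s s' : S) (c : seq S) : var c s -> var (s' :: c) s.

Fixpoint env (S : Type) (car : S -> Type) (c : seq S) : Type :=
  if c is s :: c' then (car s * env car c')%type else unit.

Fixpoint lookup (S : Type) (car : S -> Type) (c : seq S) (s : S)
    (v : var c s) : env car c -> car s :=
  match v in var c0 s0 return env car c0 -> car s0 with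
  | VHere _ _ => fun e => e.1
  | VThere _ _ _ v' => fun e => lookup v' e.2
  end.

Record language := Language {
  lsort : Type;
  fsym : Type;
  fdom : fsym -> seq lsort;
  fcod : fsym -> lsort;
  psym : Type;
  pdom : psym -> seq lsort }.

Inductive term (L : language) (c : seq (lsort L)) : lsort L -> Type :=
| TVar (s : lsort L) : var c s -> term c s
| TApp (f : fsym L) : terms c (fdom f) -> term c (fcod f)
with terms (L : language) (c : seq (lsort L)) : seq (lsort L) -> Type :=
| TNil : terms c [::]
| TCons (s : lsort L) (ss : seq (lsort L)) :
    term c s -> terms c ss -> terms c (s :: ss).

Definition unit_cube (R : realType) (n : nat) : set 'rV[R]_n :=
  [set v | forall i, 0 <= v ord0 i <= 1].

Record connective (R : realType) (n : nat) := Connective {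
  conn :> 'rV[R]_n -> R;
  conn_cont : {within @unit_cube R n, continuous conn};
  conn_unit : forall v, unit_cube v -> 0 <= conn v <= 1 }.

Inductive formula (R : realType) (L : language) : seq (lsort L) -> Type :=
| FDist (c : seq (lsort L)) (s : lsort L) :
    term c s -> term c s -> formula R c
| FPred (c : seq (lsort L)) (P : psym L) : terms c (pdom P) -> formula R c
| FConn (c : seq (lsort L)) (n : nat) (u : connective R n) :
    ('I_n -> formula R c) -> formula R c
| FSup (c : seq (lsort L)) (s : lsort L) : formula R (s :: c) -> formula R c
| FInf (c : seq (lsort L)) (s : lsort L) : formula R (s :: c) -> formula R c.

(* Moduli of uniform continuity are not part of the signature.  That a symbol
   admits the modulus e |-> delta, i.e. that d(x,y) < delta implies
   |P(x) - P(y)| <= e, is the vanishing of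
   sup_x sup_y min(delta -. d(x,y), |P(x) - P(y)| -. e); hence a modulus valid
   in M holds in all models of Th(M).  Similarly structures are prestructures:
   quotienting by d = 0 and completing do not change the values of formulas
   with uniformly continuous symbols.  Evaluation on all of H(U) is typically
   not jointly uniformly continuous, hence no modulus is imposed on it. *)
Record structure (R : realType) (L : language) := Structure {
  car : lsort L -> Type;
  car_inhabited : forall s, inhabited (car s);
  dist : forall s, car s -> car s -> R;
  dist_unit : forall s (x y : car s), 0 <= dist x y <= 1;
  dist_refl : forall s (x : car s), dist x x = 0;
  dist_sym : forall s (x y : car s), dist x y = dist y x;
  dist_tri : forall s (x y z : car s), dist x z <= dist x y + dist y z;
  fint : forall f : fsym L, env car (fdom f) -> car (fcod f);
  pint : forall P : psym L, env car (pdom P) -> R;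
  pint_unit : forall P (e : env car (pdom P)), 0 <= pint e <= 1 }.

Section Semantics.
Variables (R : realType) (L : language).
Implicit Type M N : structure R L.

Fixpoint eval_term M (c : seq (lsort L)) (s : lsort L) (t : term c s)
    (e : env (car M) c) {struct t} : car M s :=
  match t in term _ s0 return car M s0 with
  | TVar _ v => lookup v e
  | TApp f ts => fint (eval_terms ts e)
  end
with eval_terms M (c : seq (lsort L)) (ss : seq (lsort L)) (ts : terms c ss)
    (e : env (car M) c) {struct ts} : env (car M) ss :=
  match ts in terms _ ss0 return env (car M) ss0 with
  | TNil => tt
  | TCons _ _ t ts' => (eval_term t e, eval_terms ts' e)
  end.

Fixpoint feval M (c : seq (lsort L)) (psi : formula R c)
    : env (car M) c -> R :=
  match psi in formula _ c0 return env (car M) c0 -> R with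
  | FDist _ _ t t' => fun e => dist (eval_term t e) (eval_term t' e)
  | FPred _ P ts => fun e => @pint R L M P (eval_terms ts e)
  | FConn _ n u psis => fun e => u (\row_(i < n) feval (psis i) e)
  | FSup _ s psi' => fun e =>
      sup [set feval psi' ((x, e) : env (car M) (s :: _)) | x in [set: car M s]]
  | FInf _ s psi' => fun e =>
      inf [set feval psi' ((x, e) : env (car M) (s :: _)) | x in [set: car M s]]
  end.

Definition theory : Type := set (formula R ([::] : seq (lsort L))).

(* The sentence sigma stands for the condition sigma = 0. *)
Definition Th M : theory := [set sigma | @feval M [::] sigma tt = 0].

Definition models N (T : theory) : Prop :=
  forall sigma, T sigma -> @feval N [::] sigma tt = 0.

(* Value records (psi_i(b))_i of the elements b of sort s in models of T, for a
   family Delta of formulas in one variable of sort s.  Complete types are the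
   case where Delta is the family of all such formulas. *)
Definition types_over (T : theory) (s : lsort L) (I : Type)
    (Delta : I -> formula R [:: s]) : set {ptws I -> R} :=
  [set p | exists2 N, models N T &
     exists b : car N s, forall i, feval (M := N) (Delta i) (b, tt) = p i].

Definition type_space M (s : lsort L) (I : Type)
    (Delta : I -> formula R [:: s]) : Type :=
  set_type (types_over (Th M) Delta).

HB.instance Definition _ M s I Delta :=
  Topological.copy (@type_space M s I Delta)
    (set_type (types_over (Th M) Delta)).

Lemma types_over_nonempty M (s : lsort L) (I : Type)
    (Delta : I -> formula R [:: s]) :
  exists p : type_space M Delta, True.
Proof.
have [b] := car_inhabited M s.
have H : types_over (Th M) Delta
    (fun i => feval (M := M) (Delta i) (b, tt)).
  by exists M => //; exists b.
by exists (SigSub (mem_set H)).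
Qed.

HB.instance Definition _ M s I Delta :=
  isPointed.Build (@type_space M s I Delta)
    (projT1 (cid (types_over_nonempty M Delta))).

Definition complete_type_space M (s : lsort L) : ptopologicalType :=
  type_space M (fun psi : formula R [:: s] => psi).

Definition local_type_space M (s : lsort L) (I : Type)
    (Delta : I -> formula R [:: s]) : ptopologicalType :=
  type_space M Delta.

Lemma restrict_type_subproof M (s : lsort L) (I : Type)
    (Delta : I -> formula R [:: s]) (p : complete_type_space M s) :
  (fun i => val p (Delta i)) \in types_over (Th M) Delta.
Proof.
apply/mem_set; have [N NT [b bp]] := set_mem (valP p).
by exists N => //; exists b => i; exact: bp.
Qed.

Definition restrict_type M (s : lsort L) (I : Type)
    (Delta : I -> formula R [:: s]) (p : complete_type_space M s)
    : local_type_space M Delta :=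
  SigSub (restrict_type_subproof Delta p).

Definition principal_type (T : theory) (s : lsort L) (I : Type)
    (Delta : I -> formula R [:: s]) (p : I -> R) : Prop :=
  exists (c : seq (lsort L)) (psi : formula R c) (t : term c s) (r : rat),
    [/\ 0 < r,
        exists2 N, models N T & exists e : env (car N) c, feval psi e = 0 &
        forall N, models N T -> forall e : env (car N) c,
          feval psi e <= ratr r ->
          forall i, feval (M := N) (Delta i) (eval_term t e, tt) = p i].

Definition definable_pred M (ss : seq (lsort L)) (P : env (car M) ss -> R)
    : Prop :=
  forall eps : R, 0 < eps ->
    exists psi : formula R ss, forall e, `|feval psi e - P e| <= eps.

Definition definable_fun M (ss : seq (lsort L)) (s : lsort L)
    (F : env (car M) ss -> car M s) : Prop :=
  @definable_pred M (s :: ss) (fun e => dist (F e.2) e.1).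

Record dfun M := DFun {
  dfun_dom : seq (lsort L);
  dfun_cod : lsort L;
  dfun_val : env (car M) dfun_dom -> car M dfun_cod;
  dfun_def : definable_fun dfun_val }.

Record dpred M := DPred {
  dpred_dom : seq (lsort L);
  dpred_val : env (car M) dpred_dom -> R;
  dpred_unit : forall e, 0 <= dpred_val e <= 1;
  dpred_def : definable_pred dpred_val }.

Definition expansion_language M : language := {|
  lsort := lsort L;
  fsym := fsym L + dfun M;
  fdom := fun f => match f with
                   | inl f' => fdom f' | inr F => dfun_dom F end;
  fcod := fun f => match f with
                   | inl f' => fcod f' | inr F => dfun_cod F end;
  psym := psym L + dpred M;
  pdom := fun P => match P with
                   | inl P' => pdom P' | inr P' => dpred_dom P' end |}.

Definition expansion_fint M (f : fsym (expansion_language M))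
    : env (car M) (fdom f) -> car M (fcod f) :=
  match f return env (car M) (fdom (l := expansion_language M) f) ->
                 car M (fcod (l := expansion_language M) f) with
  | inl f' => @fint R L M f'
  | inr F => @dfun_val M F
  end.

Definition expansion_pint M (P : psym (expansion_language M))
    : env (car M) (pdom P) -> R :=
  match P return env (car M) (pdom (l := expansion_language M) P) -> R with
  | inl P' => @pint R L M P'
  | inr P' => @dpred_val M P'
  end.

Lemma expansion_pint_unit M (P : psym (expansion_language M))
    (e : env (car M) (pdom P)) : 0 <= expansion_pint e <= 1.
Proof.
by case: P e => P e /=; [exact: pint_unit | exact: dpred_unit].
Qed.

Definition definitional_expansion M : structure R (expansion_language M) :=
  @Structure R (expansion_language M) (car M) (car_inhabited M) (@dist R L M)
    (@dist_unit R L M) (@dist_refl R L M) (@dist_sym R L M) (@dist_tri R L M)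
    (@expansion_fint M) (@expansion_pint M) (@expansion_pint_unit M).

End Semantics.

Definition borel (Y : ptopologicalType) := g_sigma_algebraType (@open Y).

Definition regular_measure (R : realType) (Y : ptopologicalType)
    (mu : set (borel Y) -> \bar R) : Prop :=
  forall B : set (borel Y), measurable B ->
    mu B = ereal_inf [set mu O | O in [set O : set Y | open O /\ B `<=` O]] /\
    mu B = ereal_sup [set mu K | K in [set K : set Y | compact K /\ K `<=` B]].

Definition cont_fun (R : realType) (Y : topologicalType) : set (Y -> R) :=
  [set f | continuous f].
Arguments cont_fun R Y : clear implicits.

Definition reg_prob (R : realType) (Y : ptopologicalType) : Type :=
  {mu : probability (borel Y) R | `[< regular_measure mu >]}.

HB.instance Definition _ (R : realType) (Y : ptopologicalType) :=
  Choice.on (reg_prob R Y).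

Definition integrals (R : realType) (Y : ptopologicalType)
    (mu : reg_prob R Y) : {ptws cont_fun R Y -> R} :=
  fun f => (\int[val mu]_y (val f y))%R.

HB.instance Definition _ (R : realType) (Y : ptopologicalType) :=
  Topological.copy (reg_prob R Y) (initial_topology (@integrals R Y)).

Definition pushes_to (R : realType) (Y Z : ptopologicalType) (r : Y -> Z)
    (mu : reg_prob R Y) (nu : reg_prob R Z) : Prop :=
  forall B : set (borel Z), measurable B ->
    pushforward (T1 := borel Y) (T2 := borel Z) (val mu) r B = val nu B.

Definition convex_measures (R : realType) (Y : ptopologicalType)
    (A : set (reg_prob R Y)) : Prop :=
  forall mu1 mu2, A mu1 -> A mu2 -> forall t : R, 0 <= t <= 1 ->
    exists2 mu, A mu &
      forall B : set (borel Y), measurable B ->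
        val mu B = (t%:E * val mu1 B + (1 - t)%:E * val mu2 B)%E.

Definition mixture (R : realType) (I : Type) (t : R) (u v : {ptws I -> R})
    : {ptws I -> R} := fun i => t * u i + (1 - t) * v i.

Definition convex_fun_set (R : realType) (I : Type) (K : set {ptws I -> R})
    : Prop :=
  forall u v, K u -> K v -> forall t : R, 0 <= t <= 1 -> K (mixture t u v).

Definition extreme_points (R : realType) (I : Type) (K : set {ptws I -> R})
    : set {ptws I -> R} :=
  [set q | K q /\ forall u v (t : R), K u -> K v -> 0 < t < 1 ->
             q = mixture t u v -> u = q /\ v = q].

(* The cone over K placed at height 1, so that K is a base of the cone whatever
   its position in the space of functions. *)
Definition cone_over (R : realType) (I : Type) (K : set {ptws I -> R})
    : set ((I -> R) * R) :=
  [set z | exists (t : R) (q : {ptws I -> R}),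
     [/\ 0 <= t, K q, forall i, z.1 i = t * q i & z.2 = t]].

Definition cone_le (R : realType) (I : Type) (K : set {ptws I -> R})
    (z w : (I -> R) * R) : Prop :=
  cone_over K ((fun i => w.1 i - z.1 i), w.2 - z.2).

Definition choquet_simplex (R : realType) (I : Type) (K : set {ptws I -> R})
    : Prop :=
  [/\ compact K, convex_fun_set K &
      forall z w, cone_over K z -> cone_over K w ->
        exists s, [/\ cone_over K s, cone_le K z s, cone_le K w s &
          forall s', cone_over K s' -> cone_le K z s' -> cone_le K w s' ->
            cone_le K s s']].

Definition inclusion (T : Type) (V U : set T) (VU : V `<=` U) (x : V) : U :=
  SigSub (mem_set (VU _ (set_mem (valP x)))).

(* This is the topological boundary when U is open. *)
Definition bd (X : topologicalType) (U : set X) : set X := closure U `\` U.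

Definition presheaf (R : realType) (X : topologicalType) : Type :=
  forall U : set X, set (U -> R).

Definition boundary_values (R : realType) (X : topologicalType) (U : set X)
    (h : U -> R) (g : bd U -> R) : Prop :=
  forall (z : bd U) (eps : R), 0 < eps ->
    exists2 W : set X, nbhs (val z) W &
      forall x : U, W (val x) -> `|h x - g z| < eps.

Definition regular_open (R : realType) (X : topologicalType)
    (H : presheaf R X) (U : set X) : Prop :=
  [/\ open U, U !=set0, compact (closure U) &
      forall g : bd U -> R, continuous g ->
        (exists! h, H U h /\ boundary_values h g) /\
        (forall h, H U h -> boundary_values h g -> (forall z, 0 <= g z) ->
           forall x, 0 <= h x)].

Record brelot_space (R : realType) (X : topologicalType) := BrelotSpace {
  harm : presheaf R X;
  tau0 : set (set X);
  space_nonempty : [set: X] !=set0;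
  space_locally_compact : locally_compact [set: X];
  space_locally_connected : forall (x : X) (A : set X), nbhs x A ->
    exists V : set X, [/\ open V, V x, connected V & V `<=` A];
  space_hausdorff : hausdorff_space X;
  harm_continuous : forall U, open U -> forall h, @harm U h -> continuous h;
  harm_zero : forall U, open U -> @harm U (fun _ : U => 0);
  harm_linear : forall U, open U -> forall (a : R) (h1 h2 : U -> R),
    @harm U h1 -> @harm U h2 -> @harm U (fun x => a * h1 x + h2 x);
  harm_restrict : forall V U, open V -> open U -> forall VU : V `<=` U,
    forall h, @harm U h -> @harm V (h \o inclusion VU);
  harm_glue : forall (U : set X) (I : Type) (V : I -> set X)
      (VU : forall i, V i `<=` U), (forall i, open (V i)) ->
    U = \bigcup_i V i -> forall h : U -> R,
    (forall i, @harm (V i) (h \o inclusion (VU i))) -> @harm U h;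
  tau0_base : forall (x : X) (A : set X), nbhs x A ->
    exists2 U, tau0 U /\ U x & U `<=` A;
  tau0_regular : forall U, tau0 U -> regular_open (@harm) U;
  harm_monotone : forall U, tau0 U -> connected U ->
    forall h : nat -> U -> R, (forall n, @harm U (h n)) ->
    (forall n x, h n x <= h n.+1 x) ->
    (exists2 h', @harm U h' &
       forall x, ereal_sup [set (h n x)%:E | n in [set: nat]] = (h' x)%:E) \/
    (forall x, ereal_sup [set (h n x)%:E | n in [set: nat]] = +oo%E) }.

Section Potentials.
Variables (R : realType) (X : topologicalType) (B : brelot_space R X).
Local Open Scope ereal_scope.

(* The Dirichlet solution; meaningful for regular U and continuous g. *)
Definition dirichlet (U : set X) (g : bd U -> R) : U -> R :=
  xget (fun=> 0%R) [set h | harm B h /\ boundary_values h g].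

(* For connected U: there being a point where u is finite then amounts to u
   being finite on a dense set. *)
Definition superharmonic (U : set X) (u : U -> \bar R) : Prop :=
  [/\ lower_semicontinuous u,
      forall x, -oo < u x,
      exists x, u x < +oo &
      forall V : set X, regular_open (harm B) V -> closure V `<=` U ->
        forall g : bd V -> R, continuous g ->
        (forall (z : bd V) (x : U), val z = val x -> (g z)%:E <= u x) ->
        forall (v : V) (x : U), val v = val x -> (dirichlet g v)%:E <= u x].

Definition potential (U : set X) (u : U -> \bar R) : Prop :=
  [/\ superharmonic u,
      forall x, 0 <= u x &
      forall h : U -> R, harm B h -> (forall x, (h x)%:E <= u x) ->
        forall x, (h x <= 0)%R].

(* Normalizations of G(., y) by factors depending on y are irrelevant, as they
   cancel in G(x, y) / G(x0, y). *)
Definition green_kernel (U : set X) (G : U -> U -> \bar R) : Prop :=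
  [/\ forall x y, 0 < G x y,
      forall y, potential (G ^~ y),
      forall y : U, exists2 h : (U `\ val y) -> R, harm B h &
        forall (x : U) (x' : U `\ val y), val x = val x' -> G x y = (h x')%:E,
      lower_semicontinuous (fun xy : (U * U)%type => G xy.1 xy.2) &
      forall xy : (U * U)%type, xy.1 <> xy.2 ->
        {for xy, continuous (fun xy' : (U * U)%type => G xy'.1 xy'.2)}].

End Potentials.

Definition cont_boundary (R : realType) (X : topologicalType) (U : set X)
    : set (bd U -> R) := cont_fun R (bd U).
Arguments cont_boundary R {X} U.

Record martin_setting (R : realType) (X : topologicalType)
    (B : brelot_space R X) := MartinSetting {
  (* Metrics are normalized to be bounded by 1.  Those of the point sorts induce
     the topology; those of the function sorts are left arbitrary, so that every
     choice of such a metric is covered. *)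
  dX : X -> X -> R;
  dX_metric : is_unit_metric dX;
  dX_topology : metric_induces dX;
  dU : forall U : tau0 B, val U -> val U -> R;
  dU_metric : forall U, is_unit_metric (@dU U);
  dU_topology : forall U, metric_induces (@dU U);
  dH : forall U : tau0 B, @harm R X B (val U) -> @harm R X B (val U) -> R;
  dH_metric : forall U, is_unit_metric (@dH U);
  dB : forall U : tau0 B,
    cont_boundary R (val U) -> cont_boundary R (val U) -> R;
  dB_metric : forall U, is_unit_metric (@dB U);
  dom : tau0 B;
  dom_connected : connected (val dom);
  green : val dom -> val dom -> \bar R;
  greenP : green_kernel B green;
  x0 : val dom;
  beta : \bar R -> R;
  beta_continuous : {within [set t | (0 <= t)%E], continuous beta};
  beta_increasing : forall s t, (0 <= s)%E -> (s < t)%E -> beta s < beta t;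
  beta_unit : forall t, (0 <= t)%E -> 0 <= beta t <= 1;
  beta_infty : beta +oo%E = 1;
  (* phi y x is the extension of beta (G x y / G x0 y) across the diagonal. *)
  phi : val dom -> val dom -> R;
  phi_unit : forall y x, 0 <= phi y x <= 1;
  phi_green : forall y x, y <> x0 -> x <> y ->
    phi y x = beta (green x y / green x0 y)%E;
  phi_uniformly_continuous : forall eps : R, 0 < eps ->
    exists2 delta : R, 0 < delta &
      forall y y' x x', dU y y' < delta -> dU x x' < delta ->
        `|phi y x - phi y' x'| <= eps;
  param : set (val dom);
  param_dense : dense param;
  param_card : forall E : set (val dom), dense E -> (param #<= E)%card }.

Arguments param {R X B} m.

Section MartinBoundary.
Variables (R : realType) (X : topologicalType) (B : brelot_space R X).
Variable D : martin_setting B.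

Local Notation U := (val (dom D)).

Definition profile (y : U) : {compact-open, U -> R} := phi y.

(* The closure is taken in C(U, [0, 1]). *)
Definition martin_closure : set {compact-open, U -> R} :=
  closure (profile @` [set y | y <> x0 D]) `&`
  [set f | continuous (f : U -> R) /\ forall x, 0 <= f x <= 1].

Definition martin_boundary : set {compact-open, U -> R} :=
  martin_closure `\` range profile.

Definition martin_kernel_of (xi : {compact-open, U -> R}) (h : U -> R)
    : Prop :=
  [/\ harm B h, forall x, 0 < h x, h (x0 D) = 1 &
      forall x, xi x = beta D (h x)%:E].

(* In order: U is dense in its Martin closure, also through x0; the profile map
   is an embedding; profiles separate the points of U; the kernels k_xi exist.
   That boundary profiles are separated needs no clause, as the points of the
   closure are themselves functions on U. *)
Definition martin_assumptions : Prop :=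
  [/\ range profile `<=` martin_closure
        /\ martin_closure `<=` closure (range profile),
      forall (y : U) (A : set U),
        nbhs y A <-> exists2 W, nbhs (profile y) W & profile @^-1` W `<=` A,
      injective profile &
      forall xi, martin_boundary xi -> exists! h, martin_kernel_of xi h].

Definition martin_kernel (xi : {compact-open, U -> R}) : U -> R :=
  xget (fun=> 0) (martin_kernel_of xi).

Definition params : set U := param D `|` [set x0 D].

Inductive har_sort :=
| SPoint
| SDomain (V : tau0 B)
| SHarm (V : tau0 B)
| SBoundary (V : tau0 B).

Inductive har_fsym :=
| FPoint (V : tau0 B)
| FIncl (V W : tau0 B) (VW : val V `<=` val W)
| FRestrict (V W : tau0 B) (VW : val V `<=` val W)
| FDirichlet (V : tau0 B)
| FConst (a : params).

Inductive har_psym :=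
| PEval (V : tau0 B)
| PPhi.

Definition har_fdom (f : har_fsym) : seq har_sort :=
  match f with
  | FPoint V => [:: SDomain V]
  | FIncl V W _ => [:: SDomain V]
  | FRestrict V W _ => [:: SHarm W]
  | FDirichlet V => [:: SBoundary V]
  | FConst _ => [::]
  end.

Definition har_fcod (f : har_fsym) : har_sort :=
  match f with
  | FPoint _ => SPoint
  | FIncl V W _ => SDomain W
  | FRestrict V W _ => SHarm V
  | FDirichlet V => SHarm V
  | FConst _ => SDomain (dom D)
  end.

Definition har_pdom (P : har_psym) : seq har_sort :=
  match P with
  | PEval V => [:: SHarm V; SDomain V]
  | PPhi => [:: SDomain (dom D); SDomain (dom D)]
  end.

Definition har_language : language :=
  @Language har_sort har_fsym har_fdom har_fcod har_psym har_pdom.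

Definition har_car (s : har_sort) : Type :=
  match s with
  | SPoint => X
  | SDomain V => val V
  | SHarm V => @harm R X B (val V)
  | SBoundary V => cont_boundary R (val V)
  end.

Lemma tau0_open (V : tau0 B) : open (val V).
Proof. by have [] := tau0_regular (set_mem (valP V)). Qed.

Lemma har_car_inhabited (s : har_sort) : inhabited (har_car s).
Proof.
case: s => [|V|V|V] /=.
- by have [x _] := space_nonempty B; exact: (inhabits x).
- have [_ [x Vx] _ _] := tau0_regular (set_mem (valP V)).
  exact: inhabits (SigSub (mem_set Vx)).
- have h0 : @harm R X B (val V) (fun=> 0) := harm_zero B (tau0_open V).
  exact: inhabits (SigSub (mem_set (A := @harm R X B (val V)) h0)).
- have c0 : cont_boundary R (val V) (fun=> 0) by exact: cst_continuous.
  exact: inhabits (SigSub (mem_set (A := cont_boundary R (val V)) c0)).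
Qed.

Definition har_dist (s : har_sort) : har_car s -> har_car s -> R :=
  match s return har_car s -> har_car s -> R with
  | SPoint => @dX _ _ _ D
  | SDomain V => @dU _ _ _ D V
  | SHarm V => @dH _ _ _ D V
  | SBoundary V => @dB _ _ _ D V
  end.

Lemma har_dist_metric (s : har_sort) : is_unit_metric (@har_dist s).
Proof.
case: s => [|V|V|V] /=.
- exact: dX_metric.
- exact: dU_metric.
- exact: dH_metric.
- exact: dB_metric.
Qed.

Lemma har_dist_unit s (x y : har_car s) : 0 <= har_dist x y <= 1.
Proof. by have [[d0 _ _ _] d1] := har_dist_metric s; rewrite d0 d1. Qed.

Lemma har_dist_refl s (x : har_car s) : har_dist x x = 0.
Proof. by have [[_ dE _ _] _] := har_dist_metric s; apply/dE. Qed.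

Lemma har_dist_sym s (x y : har_car s) : har_dist x y = har_dist y x.
Proof. by have [[_ _ dC _] _] := har_dist_metric s; exact: dC. Qed.

Lemma har_dist_tri s (x y z : har_car s) :
  har_dist x z <= har_dist x y + har_dist y z.
Proof. by have [[_ _ _ dT] _] := har_dist_metric s; exact: dT. Qed.

Lemma restrict_subproof (V W : tau0 B) (VW : val V `<=` val W)
    (h : @harm R X B (val W)) :
  (val h \o inclusion VW) \in @harm R X B (val V).
Proof.
apply/mem_set/(harm_restrict (tau0_open V) (tau0_open W)).
exact: set_mem (valP h).
Qed.

Lemma dirichlet_subproof (V : tau0 B) (g : cont_boundary R (val V)) :
  dirichlet B (val g) \in @harm R X B (val V).
Proof.
have [_ _ _ /(_ _ (set_mem (valP g)))[[h [Hh _]] _]] :=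
  tau0_regular (set_mem (valP V)).
by apply/mem_set; rewrite /dirichlet; case: xgetP => [f _ []|/(_ h)].
Qed.

Definition har_fint (f : har_fsym)
    : env har_car (har_fdom f) -> har_car (har_fcod f) :=
  match f return env har_car (har_fdom f) -> har_car (har_fcod f) with
  | FPoint V => fun e => val e.1
  | FIncl V W VW => fun e => inclusion VW e.1
  | FRestrict V W VW => fun e => SigSub (restrict_subproof VW e.1)
  | FDirichlet V => fun e => SigSub (dirichlet_subproof e.1)
  | FConst a => fun _ => val a
  end.

(* An increasing homeomorphism of the real line onto ]0, 1[, which turns real
   evaluations into values of a [0, 1]-valued predicate. *)
Definition squash (t : R) : R := (1 + t / (1 + `|t|)) / 2.

Lemma squash_unit (t : R) : 0 <= squash t <= 1.
Proof.
have d0 : 0 < 1 + `|t| by rewrite ltr_pwDl.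
have H : `|t / (1 + `|t|)| <= 1.
  by rewrite normrM normfV (gtr0_norm d0) ler_pdivrMr// mul1r lerDr.
move: H; rewrite ler_norml /squash => /andP[H1 H2]; apply/andP; split; lra.
Qed.

Definition har_pint (P : har_psym) : env har_car (har_pdom P) -> R :=
  match P return env har_car (har_pdom P) -> R with
  | PEval V => fun e => squash (val e.1 e.2.1)
  | PPhi => fun e => phi e.1 e.2.1
  end.

Lemma har_pint_unit (P : har_psym) (e : env har_car (har_pdom P)) :
  0 <= har_pint e <= 1.
Proof.
by case: P e => [V|] e; [exact: squash_unit | exact: phi_unit].
Qed.

Definition har_structure : structure R har_language :=
  @Structure R har_language har_car har_car_inhabited har_dist
    har_dist_unit har_dist_refl har_dist_sym har_dist_tri
    har_fint har_pint har_pint_unit.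

Definition martin_language : language := expansion_language har_structure.

Definition martin_structure : structure R martin_language :=
  definitional_expansion har_structure.

Definition point_sort : lsort martin_language := SDomain (dom D).

Definition phi_at (a : params) : formula R [:: point_sort] :=
  @FPred R martin_language [:: point_sort] (inl PPhi)
    (TCons (TVar (VHere point_sort [::]))
      (TCons (@TApp martin_language [:: point_sort] (inl (FConst a)) (TNil _))
        (TNil _))).

Definition S1 : ptopologicalType :=
  complete_type_space martin_structure point_sort.

Definition Sphi : ptopologicalType :=
  local_type_space martin_structure phi_at.

Definition r_phi : S1 -> Sphi := restrict_type phi_at.

Definition phi_value (p : Sphi) : {ptws params -> R} := val p.

Definition C_phi : set Sphi :=
  closure [set p | exists2 y : U, y <> x0 D &
                     forall a : params, phi_value p a = phi y (val a)].

Definition np_boundary : set Sphi :=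
  C_phi `&`
  [set p | ~ principal_type (Th martin_structure) phi_at (phi_value p)].

(* Gamma sends xi to the type with values xi a; it is injective because the
   members of the closure are continuous and params is dense. *)
Definition Gamma_inv (p : Sphi) : {compact-open, U -> R} :=
  xget (fun=> 0) [set xi | martin_closure xi /\
                           forall a : params, phi_value p a = xi (val a)].

Definition H1 : set {ptws params -> R} :=
  [set q | exists h : U -> R,
     [/\ harm B h, forall x, 0 <= h x, h (x0 D) = 1 &
         forall a : params, q a = h (val a)]].

Definition frakh (p : Sphi) : {ptws params -> R} :=
  fun a => martin_kernel (Gamma_inv p) (val a).

Definition min_np_boundary : set Sphi :=
  np_boundary `&` frakh @^-1` extreme_points H1.

Definition represents (q : {ptws params -> R}) (nu : reg_prob R Sphi) : Prop :=
  (val nu).-negligible (~` min_np_boundary) /\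
  forall a : params,
    (\int[val nu]_(p in min_np_boundary) (frakh p a)%:E = (q a)%:E)%E.

Definition unique_representing (q : {ptws params -> R})
    (nu : reg_prob R Sphi) : Prop :=
  represents q nu /\
  forall nu', represents q nu' ->
    forall E : set (borel Sphi), measurable E -> val nu' E = val nu E.

Definition Lift (nu : reg_prob R Sphi) : set (reg_prob R S1) :=
  [set mu | pushes_to r_phi mu nu].

End MartinBoundary.

Arguments params {R X B} D.
Arguments H1 {R X B} D.
Arguments r_phi {R X B} D.

(* Main.v *)
Require Import Defs.
From HB Require Import structures.
From mathcomp Require Import all_boot all_order all_algebra.
From mathcomp Require Import all_classical all_reals all_analysis.
From mathcomp Require Import measurable_realfun lra.

Set Implicit Arguments.
Unset Strict Implicit.
Unset Printing Implicit Defensive.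

Import Order.TTheory GRing.Theory Num.Theory numFieldNormedType.Exports.
Local Open Scope classical_set_scope.
Local Open Scope ring_scope.

(** Both [S1 D] and [Sphi D] are spaces of types of one first-order theory, hence
    compact Hausdorff, and [r_phi] is a continuous surjection of the first onto
    the second, because a realization of a local type also has a complete type.
    The statement is then an instance of a general fact: along a continuous
    surjection [r] of compact Hausdorff spaces every regular Borel probability
    measure lifts, and the lifts form a compact convex set.

    Compactness of the type spaces is the compactness theorem of continuous
    logic ([type_space_compact]). It is proved by ultraproducts: the limit of an
    ultrafilter of types is realized in the ultraproduct of models realizing
    these types, by Los's theorem ([feval_ultraproduct]).

    The measures are handled through their integrals. By the Riesz-Markov theorem
    ([riesz_markov]) every normalized positive functional on the continuous
    functions of a compact Hausdorff space is integration against a regular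
    probability measure; this measure is unique ([regular_eq_of_integrals]), and
    the space of such measures is weak-* compact ([reg_prob_compact]). As the
    image of a regular measure is regular, [r] pushes [mu] to [nu] if and only if
    [F \o r] has the same integral for [mu] as [F] for [nu], for all continuous
    [F] ([pushes_toP]). This describes the lifts of [nu] by equations that are
    continuous in [mu], so they form a compact set. It is convex because a
    mixture of regular measures is regular ([lift_convex]).

    It remains to find one lift ([lift_exists]). By compactness it is enough to
    satisfy finitely many of the equations up to a given error. To this end one
    moves every point of the target to a representative of its piece in a
    countable Borel partition on which the finitely many functions hardly vary;
    composed with this map, an arbitrary, possibly non-measurable, section of [r]
    becomes measurable and carries [nu] to an approximate lift. *)

(** * Ultralimits of bounded real families *)

Section Ultralimit.
Variables (R : realType) (I : Type) (F : set_system I).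
Context {FU : UltraFilter F}.
Implicit Types f g : I -> R.

Let FP : ProperFilter F := ultra_proper.

Definition ultralimit f : R := lim (f @ F).

(** A cluster point of an ultrafilter is a limit of it, and the compact interval
    [[-M, M]] provides a cluster point. *)
Lemma ultralimit_cvg f (M : R) :
  (forall i, `|f i| <= M) -> f @ F --> ultralimit f.
Proof.
move=> fM; suff [l fl] : exists l : R, f @ F --> l.
  by rewrite (_ : ultralimit f = l)//; apply: cvg_lim fl; exact: norm_hausdorff.
have fF : (f @ F) `[(- M), M]%classic.
  by apply: (@filterE _ F) => i; rewrite /= in_itv /= -ler_norml.
have [l [_ cl]] := @segment_compact R (- M) M _ (fmap_proper_filter f FP) fF.
exists l => A Al; have [//|FnA] := in_ultra_setVsetC (f @^-1` A) FU.
by have [x []] := cl (~` A) A FnA Al.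
Qed.

Lemma ultralimitP f (l : R) : f @ F --> l -> ultralimit f = l.
Proof. by apply: cvg_lim; exact: norm_hausdorff. Qed.

Lemma ultralimit_ge c f (M : R) : (forall i, `|f i| <= M) ->
  (\forall i \near F, c <= f i) -> c <= ultralimit f.
Proof. by move=> /ultralimit_cvg cf; apply: limr_ge; exact: (cvgP _ cf). Qed.

Lemma ultralimit_le f g (M : R) : (forall i, `|f i| <= M) ->
  (forall i, `|g i| <= M) -> (\forall i \near F, f i <= g i) ->
  ultralimit f <= ultralimit g.
Proof.
move=> fM gM fg; rewrite -subr_ge0.
have cgf : (fun i => g i - f i) @ F --> ultralimit g - ultralimit f.
  by apply: cvgB; apply: ultralimit_cvg; [exact: gM | exact: fM].
rewrite -(ultralimitP cgf); apply: limr_ge; first exact: (cvgP _ cgf).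
by apply: filterS fg => i; rewrite subr_ge0.
Qed.

Lemma ultralimit_cst (c : R) : ultralimit (fun=> c) = c.
Proof. by apply: ultralimitP; exact: cvg_cst. Qed.

Lemma ultralimit_opp f (M : R) : (forall i, `|f i| <= M) ->
  ultralimit (fun i => - f i) = - ultralimit f.
Proof.
by move=> fM; apply: ultralimitP; apply: cvgN; exact: ultralimit_cvg fM.
Qed.

Lemma ultralimit_add f g (M : R) : (forall i, `|f i| <= M) ->
  (forall i, `|g i| <= M) ->
  ultralimit (fun i => f i + g i) = ultralimit f + ultralimit g.
Proof.
move=> fM gM; apply: ultralimitP.
by apply: cvgD; [exact: ultralimit_cvg fM | exact: ultralimit_cvg gM].
Qed.

(** The ultraproduct consists of all families [x], so that nearly optimal points
    [x i] can be chosen separately in each [T i]; this is why suprema commute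
    with ultralimits. *)
Lemma ultralimit_sup (T : I -> Type) (g : forall i, T i -> R) (M : R) :
  (forall i, inhabited (T i)) -> (forall i x, `|g i x| <= M) ->
  sup [set ultralimit (fun i => g i (x i)) | x in [set: forall i, T i]]
  = ultralimit (fun i => sup [set g i x | x in [set: T i]]).
Proof.
move=> T0 gM.
pose a i := sup [set g i x | x in [set: T i]].
have hs i : has_sup [set g i x | x in [set: T i]].
  split; first by have [x] := T0 i; exists (g i x), x.
  by exists M => _ [x _ <-]; exact: le_trans (ler_norm _) (gM _ _).
have ga i x : g i x <= a i by apply: ub_le_sup; [exact: (hs i).2 | exists x].
have aM i : `|a i| <= M.
  rewrite ler_norml; apply/andP; split; last first.
    apply: ge_sup; first exact: (hs i).1.
    by move=> _ [x _ <-]; exact: le_trans (ler_norm _) (gM _ _).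
  have [x] := T0 i; apply: le_trans (ga i x).
  by have := gM i x; rewrite ler_norml => /andP[].
apply/eqP; rewrite eq_le; apply/andP; split.
  apply: ge_sup.
    have T1 i : exists x : T i, True by have [x] := T0 i; exists x.
    pose x i := projT1 (cid (T1 i)).
    by exists (ultralimit (fun i => g i (x i))), x.
  move=> _ [x _ <-]; apply: ultralimit_le (fun i => gM i (x i)) aM _.
  by apply: (@filterE _ F) => i; exact: ga.
apply/ler_addgt0Pr => e e0.
have exx i : exists x : T i, a i - e < g i x.
  by have [_ [x _ <-] gx] := sup_adherent e0 (hs i); exists x.
pose x i := projT1 (cid (exx i)).
have xP i : a i - e < g i (x i) by exact: projT2 (cid (exx i)).
rewrite -lerBlDr; apply: (@le_trans _ _ (ultralimit (fun i => g i (x i)))).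
  rewrite -[e]ultralimit_cst -(ultralimit_opp (M := e)); last first.
    by move=> i; rewrite (gtr0_norm e0) lexx.
  rewrite -(ultralimit_add (M := M + e)).
  - apply: (ultralimit_le (M := M + e)).
    + move=> i; apply: le_trans (ler_normB _ _) _.
      by apply: lerD; [exact: aM | rewrite (gtr0_norm e0)].
    + by move=> i; apply: le_trans (gM _ _) _; rewrite lerDl ltW.
    + by apply: (@filterE _ F) => i; exact: ltW (xP i).
  - by move=> i; apply: le_trans (aM i) _; rewrite lerDl ltW.
  - move=> i; rewrite normrN (gtr0_norm e0) lerDr.
    by have [y] := T0 i; apply: le_trans (normr_ge0 _) (gM i y).
apply: ub_le_sup; last by exists x.
exists M => _ [y _ <-]; rewrite -[M]ultralimit_cst.
apply: (ultralimit_le (M := M)) => //; last first.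
  by apply: (@filterE _ F) => i; exact: le_trans (ler_norm _) (gM _ _).
move=> i; rewrite ger0_norm//.
by have [z] := T0 i; apply: le_trans (normr_ge0 _) (gM i z).
Qed.

Lemma ultralimit_inf (T : I -> Type) (g : forall i, T i -> R) (M : R) :
  (forall i, inhabited (T i)) -> (forall i x, `|g i x| <= M) ->
  inf [set ultralimit (fun i => g i (x i)) | x in [set: forall i, T i]]
  = ultralimit (fun i => inf [set g i x | x in [set: T i]]).
Proof.
move=> T0 gM; rewrite /inf image_comp /=.
have gNM i x : `|- g i x| <= M by rewrite normrN.
transitivity (- ultralimit (fun i => sup [set - g i x | x in [set: T i]])).
  congr (- _); rewrite -(ultralimit_sup T0 gNM); congr sup.
  by apply: eq_imagel => x _ /=; rewrite (ultralimit_opp (M := M)).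
rewrite -(ultralimit_opp (M := M)).
  by congr ultralimit; apply/funext => i; rewrite image_comp.
move=> i; rewrite ler_norml; apply/andP; split; last first.
  apply: ge_sup; first by have [x] := T0 i; exists (- g i x), x.
  by move=> _ [x _ <-]; exact: le_trans (ler_norm _) (gNM _ _).
have [x] := T0 i; apply: (@le_trans _ _ (- g i x)).
  by have := gM i x; rewrite ler_norml lerN2 => /andP[].
apply: ub_le_sup; last by exists x.
by exists M => _ [y _ <-]; exact: le_trans (ler_norm _) (gNM _ _).
Qed.
End Ultralimit.

(** * Ultraproducts *)

Scheme term_mutind := Induction for term Sort Prop
  with terms_mutind := Induction for terms Sort Prop.

Section FormulaValues.
Variables (R : realType) (L : language).

Lemma sup_unit (S : set R) : S !=set0 -> (forall x, S x -> 0 <= x <= 1) ->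
  0 <= sup S <= 1.
Proof.
move=> [x Sx] S01; have /andP[x0 _] := S01 x Sx; apply/andP; split.
  apply: le_trans x0 _; apply: ub_le_sup => //.
  by exists 1 => y /S01 /andP[].
by apply: ge_sup; [exists x | move=> y /S01 /andP[]].
Qed.

Lemma inf_unit (S : set R) : S !=set0 -> (forall x, S x -> 0 <= x <= 1) ->
  0 <= inf S <= 1.
Proof.
move=> [x Sx] S01; have /andP[_ x1] := S01 x Sx; apply/andP; split.
  by apply: lb_le_inf; [exists x | move=> y /S01 /andP[]].
apply: le_trans x1; apply: ge_inf => //.
by exists 0 => y /S01 /andP[].
Qed.

Lemma feval_unit (M : structure R L) (c : seq (lsort L)) (psi : formula R c)
  (e : env (car M) c) : 0 <= feval (M := M) psi e <= 1.
Proof.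
elim: psi e => {c} /= [c s t t' e|c P ts e|c n u psis IH e|c s psi IH e
  |c s psi IH e].
- exact: dist_unit.
- exact: pint_unit.
- by apply: conn_unit => i; rewrite mxE.
- have [x] := car_inhabited M s.
  by apply: sup_unit => [|_ [y _ <-]]; [eexists; exists x | exact: IH].
- have [x] := car_inhabited M s.
  by apply: inf_unit => [|_ [y _ <-]]; [eexists; exists x | exact: IH].
Qed.

Lemma feval_norm (M : structure R L) (c : seq (lsort L)) (psi : formula R c)
  (e : env (car M) c) : `|feval (M := M) psi e| <= 1.
Proof. by have /andP[p0 p1] := feval_unit psi e; rewrite ger0_norm. Qed.

End FormulaValues.

Section Ultraproduct.
Variables (R : realType) (L : language) (I : Type) (F : set_system I).
Context {FU : UltraFilter F}.
Variable N : I -> structure R L.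

Let FP : ProperFilter F := ultra_proper.

(** Structures need neither be complete nor separate points at distance 0, so the
    full product of the carriers serves as carrier: families are not identified,
    only their distances are ultralimits. *)
Definition ultra_car (s : lsort L) : Type := forall i, car (N i) s.

Lemma ultra_car_inhabited (s : lsort L) : inhabited (ultra_car s).
Proof.
have ex i : exists x : car (N i) s, True.
  by have [x] := car_inhabited (N i) s; exists x.
exact: (inhabits (fun i => projT1 (cid (ex i)))).
Qed.

Definition ultra_dist (s : lsort L) (x y : ultra_car s) : R :=
  ultralimit F (fun i => dist (x i) (y i)).

Let dist_norm i s (x y : car (N i) s) : `|dist x y| <= 1.
Proof. by have /andP[d0 d1] := dist_unit x y; rewrite ger0_norm. Qed.

Let unit_norm (x : R) : 0 <= x <= 1 -> `|x| <= 1.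
Proof. by move=> /andP[d0 d1]; rewrite ger0_norm. Qed.

Lemma ultralimit_unit (f : I -> R) : (forall i, 0 <= f i <= 1) ->
  0 <= ultralimit F f <= 1.
Proof.
move=> f01; have fM i : `|f i| <= 1 by exact: unit_norm.
apply/andP; split.
  apply: ultralimit_ge fM _.
  by apply: (@filterE _ F) => i; case/andP: (f01 i).
rewrite -[leRHS](ultralimit_cst (F := F)); apply: (ultralimit_le fM).
  by move=> i; rewrite normr1.
by apply: (@filterE _ F) => i; case/andP: (f01 i).
Qed.

Lemma ultra_dist_unit s (x y : ultra_car s) : 0 <= ultra_dist x y <= 1.
Proof. by apply: ultralimit_unit => i; exact: dist_unit. Qed.

Lemma ultra_dist_refl s (x : ultra_car s) : ultra_dist x x = 0.
Proof.
rewrite /ultra_dist (_ : (fun i => _) = fun=> 0) ?ultralimit_cst//.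
by apply/funext => i; exact: dist_refl.
Qed.

Lemma ultra_dist_sym s (x y : ultra_car s) : ultra_dist x y = ultra_dist y x.
Proof.
by congr ultralimit; apply/funext => i; exact: dist_sym.
Qed.

Lemma ultra_dist_tri s (x y z : ultra_car s) :
  ultra_dist x z <= ultra_dist x y + ultra_dist y z.
Proof.
rewrite /ultra_dist -(ultralimit_add (M := 1))//.
apply: (ultralimit_le (M := 1 + 1)).
- by move=> i; apply: le_trans (dist_norm _ _) _; rewrite lerDl.
- move=> i; apply: le_trans (ler_normD _ _) _.
  by apply: lerD; exact: dist_norm.
- by apply: (@filterE _ F) => i; exact: dist_tri.
Qed.

Fixpoint env_at (i : I) (c : seq (lsort L)) :
    env ultra_car c -> env (car (N i)) c :=
  if c is s :: c' then fun e => (e.1 i, env_at i e.2) else fun=> tt.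

Definition ultra_pint (P : psym L) (e : env ultra_car (pdom P)) : R :=
  ultralimit F (fun i => pint (env_at i e)).

Lemma ultra_pint_unit P (e : env ultra_car (pdom P)) : 0 <= ultra_pint e <= 1.
Proof. by apply: ultralimit_unit => i; exact: pint_unit. Qed.

Definition ultraproduct : structure R L :=
  @Structure R L ultra_car ultra_car_inhabited ultra_dist
    ultra_dist_unit ultra_dist_refl ultra_dist_sym ultra_dist_tri
    (fun f e i => fint (env_at i e)) ultra_pint ultra_pint_unit.

Lemma lookup_at i (c : seq (lsort L)) s (v : var c s) (e : env ultra_car c) :
  lookup v e i = lookup v (env_at i e).
Proof. by elim: v e => //= s' s'' c' v IH e; exact: IH. Qed.

Lemma eval_term_at i (c : seq (lsort L)) s (t : term c s)
    (e : env ultra_car c) :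
  eval_term (M := ultraproduct) t e i = eval_term t (env_at i e).
Proof.
move: s t; apply: (@term_mutind L c
  (fun s t => eval_term (M := ultraproduct) t e i
              = eval_term t (env_at i e))
  (fun ss ts => env_at i (eval_terms (M := ultraproduct) ts e)
              = eval_terms ts (env_at i e))) => //=.
- by move=> s v; exact: lookup_at.
- by move=> f ts ->.
- by move=> s ss t -> ts ->.
Qed.

Lemma eval_terms_at i (c ss : seq (lsort L)) (ts : terms c ss)
    (e : env ultra_car c) :
  env_at i (eval_terms (M := ultraproduct) ts e) = eval_terms ts (env_at i e).
Proof.
by elim: ts => //= s ss' t ts ->; rewrite eval_term_at.
Qed.

(** Continuity of the connective on the cube turns the coordinatewise convergence
    of the arguments along [F] into convergence of the values. *)
Lemma connective_ultralimit n (u : connective R n) (v : I -> 'I_n -> R) :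
  (forall i j, 0 <= v i j <= 1) ->
  u (\row_j ultralimit F (v ^~ j)) = ultralimit F (fun i => u (\row_j v i j)).
Proof.
move=> v01; apply/esym/ultralimitP.
have cube_lim : unit_cube (\row_j ultralimit F (v ^~ j)).
  by move=> j; rewrite mxE; apply: ultralimit_unit.
have /subspace_continuousP/(_ _ cube_lim) ucont := @conn_cont R n u.
have rowcvg : (fun i => \row_j v i j) @ F --> \row_j ultralimit F (v ^~ j).
  apply/cvg_mx_entourageP => A; rewrite -entourage_ballE => -[e /= e0 eA].
  have : \forall i \near F, forall j : 'I_n,
      ball (ultralimit F (v ^~ j)) e (v i j).
    apply: filter_forall => j.
    have vM i : `|v i j| <= 1 by exact: unit_norm.
    by have vcvg := (cvgrPdist_lt _ _).1 (ultralimit_cvg vM); exact: vcvg.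
  apply: filterS => i vi k j; rewrite !mxE; apply/mem_set/eA => /=.
  exact: vi.
move=> A /ucont; rewrite /nbhs /= /within /= => uA.
have := rowcvg _ uA; rewrite /nbhs /=; apply: filterS => i; apply.
by move=> j; rewrite mxE.
Qed.

(** Los's theorem. Atomic formulas are the definition of the ultraproduct,
    connectives are [connective_ultralimit], and the quantifiers are
    [ultralimit_sup] and [ultralimit_inf]. *)
Lemma feval_ultraproduct (c : seq (lsort L)) (psi : formula R c)
    (e : env ultra_car c) :
  feval (M := ultraproduct) psi e
  = ultralimit F (fun i => feval (M := N i) psi (env_at i e)).
Proof.
elim: psi e => {c} /= [c s t t' e|c P ts e|c n u psis IH e|c s psi IH e
  |c s psi IH e].
- rewrite /ultra_dist; congr ultralimit; apply/funext => i.
  by rewrite !eval_term_at.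
- rewrite /ultra_pint; congr ultralimit; apply/funext => i.
  by rewrite eval_terms_at.
- rewrite -connective_ultralimit; last by move=> i j; exact: feval_unit.
  by congr (conn u _); apply/rowP => j; rewrite !mxE IH.
- rewrite -(ultralimit_sup (M := 1)).
  + by congr sup; apply: eq_imagel => x _; rewrite IH.
  + by move=> i; exact: car_inhabited.
  + by move=> i x; exact: feval_norm.
- rewrite -(ultralimit_inf (M := 1)).
  + by congr inf; apply: eq_imagel => x _; rewrite IH.
  + by move=> i; exact: car_inhabited.
  + by move=> i x; exact: feval_norm.
Qed.

Lemma models_ultraproduct (T : theory R L) :
  (forall i, models (N i) T) -> models ultraproduct T.
Proof.
move=> NT sigma Tsigma; rewrite feval_ultraproduct /=.
rewrite (_ : (fun i => _) = fun=> 0) ?ultralimit_cst//.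
by apply/funext => i; exact: NT.
Qed.

End Ultraproduct.

(** * Spaces of types *)

Section TypeSpaces.

Lemma initial_cvg (S : choiceType) (T : topologicalType) (f : S -> T)
    (F : set_system S) (s : S) : Filter F ->
  f @ F --> f s -> F --> (s : initial_topology f).
Proof.
move=> FF fFs A /= [_ [[B oB <-] Bs sBA]].
have : nbhs (f s) B by apply: open_nbhs_nbhs.
by move/fFs; apply: filterS sBA.
Qed.

Lemma ptws_cvgP (I : Type) (V : topologicalType)
    (F : set_system {ptws I -> V}) (f : {ptws I -> V}) : Filter F ->
  F --> f <-> forall i, (fun g : {ptws I -> V} => g i) @ F --> f i.
Proof.
move=> FF; split => [/cvg_sup Ff i|Ff].
  apply: cvg_trans (@initial_continuous _ _ (fun g : {ptws I -> V} => g i) f).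
  exact: (cvg_app _ (Ff i)).
by apply/cvg_sup => i; apply: initial_cvg; exact: Ff.
Qed.

Lemma proj_ptws_continuous (I : Type) (V : topologicalType) (i : I) :
  continuous (fun g : {ptws I -> V} => g i).
Proof. by move=> f; have [+ _] := ptws_cvgP f (nbhs_filter f); exact. Qed.

Lemma set_type_cvg (I : Type) (V : topologicalType) (A : set {ptws I -> V})
    (F : set_system A) (p : A) : Filter F ->
  (forall i, (fun q : A => (val q : {ptws I -> V}) i) @ F -->
             (val p : {ptws I -> V}) i) ->
  F --> p.
Proof.
move=> FF Fp; apply: initial_cvg.
have [_] := ptws_cvgP (val p : {ptws I -> V})
  (fmap_filter (val : A -> {ptws I -> V}) FF).
by apply; exact: Fp.
Qed.

Lemma coord_continuous (I : Type) (V : topologicalType) (A : set {ptws I -> V})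
    (i : I) :
  continuous (fun q : A => (val q : {ptws I -> V}) i).
Proof.
have cval : continuous (val : A -> {ptws I -> V}).
  exact: (@initial_continuous _ _ (val : A -> {ptws I -> V})).
move=> q; exact: cvg_comp (cval q) (@proj_ptws_continuous I V i (val q)).
Qed.

Lemma separating_hausdorff (T U : topologicalType) (I : Type)
    (f : I -> T -> U) :
  hausdorff_space U -> (forall i, continuous (f i)) ->
  (forall p q, (forall i, f i p = f i q) -> p = q) -> hausdorff_space T.
Proof.
move=> hU fc finj p q pq; apply: finj => i; apply: hU => A B Ap Bq.
have [x [Ax Bx]] := pq _ _ (fc i p _ Ap) (fc i q _ Bq).
by exists (f i x).
Qed.

Variables (R : realType) (L : language) (M : structure R L) (s : lsort L).

Lemma type_space_hausdorff (I : Type) (Delta : I -> formula R [:: s]) :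
  hausdorff_space (type_space M Delta).
Proof.
apply: (@separating_hausdorff _ R I
  (fun i (p : types_over (Th M) Delta) => (val p : {ptws I -> R}) i)).
- exact: norm_hausdorff.
- by move=> i; exact: coord_continuous.
- by move=> p q pq; apply: val_inj; apply/funext.
Qed.

(** The compactness theorem. Given an ultrafilter on the type space, realize each
    type [p] by some [b p] in a model [N p]. By Los's theorem the ultraproduct
    of the [N p] along this very ultrafilter is a model of the theory in which
    the family [b] realizes the limit of the types. *)
Lemma type_space_compact (I : Type) (Delta : I -> formula R [:: s]) :
  compact [set: type_space M Delta].
Proof.
rewrite compact_ultra => F FU _.
have real (p : type_space M Delta) : exists Nb : {N : structure R L & car N s},
    models (projT1 Nb) (Th M) /\
    forall i, feval (M := projT1 Nb) (Delta i) (projT2 Nb, tt) = val p i.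
  have [N NT [b bp]] := set_mem (valP p).
  by exists (existT (fun N : structure R L => car N s) N b).
pose N p := projT1 (projT1 (cid (real p))).
pose U := @ultraproduct R L _ F FU N.
pose b : car U s := fun p => projT2 (projT1 (cid (real p))).
have NT p : models (N p) (Th M) by have [] := projT2 (cid (real p)).
have Nb p i : feval (M := N p) (Delta i) (b p, tt) = val p i.
  by have [_] := projT2 (cid (real p)).
have lim_type : types_over (Th M) Delta
    (fun i => feval (M := U) (Delta i) (b, tt)).
  exists U; first exact: (models_ultraproduct (FU := FU)).
  by exists b.
exists (SigSub (mem_set lim_type)); split => //.
apply: set_type_cvg => i.
rewrite [X in _ --> X](_ : _ = ultralimit F (fun p => val p i)); last first.
  by rewrite /= feval_ultraproduct; congr ultralimit; apply/funext.
apply: (ultralimit_cvg (M := 1)) => p.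
by rewrite -Nb; exact: feval_norm.
Qed.

Lemma restrict_type_continuous (I : Type) (Delta : I -> formula R [:: s]) :
  continuous (restrict_type (M := M) Delta).
Proof.
move=> p; apply: (@set_type_cvg I R (types_over (Th M) Delta) _ _
  (fmap_filter (restrict_type (M := M) Delta) (nbhs_filter p))) => i.
exact: (@coord_continuous _ _
  (types_over (Th M) (fun psi : formula R [:: s] => psi)) (Delta i) p).
Qed.

Lemma restrict_type_surjective (I : Type) (Delta : I -> formula R [:: s])
    (p : local_type_space M Delta) :
  exists p' : complete_type_space M s, restrict_type Delta p' = p.
Proof.
have [N NT [b bp]] := set_mem (valP p).
have p'P : types_over (Th M) (fun psi : formula R [:: s] => psi)
    (fun psi => feval (M := N) psi (b, tt)).
  by exists N => //; exists b.
exists (SigSub (mem_set p'P)); apply: val_inj.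
by apply/funext => i /=; rewrite bp.
Qed.

End TypeSpaces.

(** * Regular probability measures on a compact Hausdorff space *)

Section CompactHausdorff.
Variables (R : realType) (Y : ptopologicalType).
Hypotheses (hY : hausdorff_space Y) (cY : compact [set: Y]).

Lemma continuous_separation (A B : set Y) : closed A -> closed B ->
  A `&` B = set0 ->
  exists h : Y -> R, [/\ continuous h, forall x, 0 <= h x <= 1,
    forall x, A x -> h x = 0 & forall x, B x -> h x = 1].
Proof.
move=> clA clB AB0.
have sep := (@normal_separatorP R Y).1 (compact_normal hY cY) _ _ clA clB AB0.
exists (@Urysohn Y R A B); split.
- exact: Urysohn_continuous.
- move=> x; have : range (@Urysohn Y R A B) (Urysohn A B x) by exists x.
  by move/Urysohn_range; rewrite /= in_itv.
- by move=> x Ax; apply: (@Urysohn_sub0 Y R A B sep); exists x.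
- by move=> x Bx; apply: (@Urysohn_sub1 Y R A B sep); exists x.
Qed.

Lemma closed_compact_space (A : set Y) : closed A -> compact A.
Proof. by move=> clA; exact: subclosed_compact clA cY _. Qed.

Lemma compact_closed_space (A : set Y) : compact A -> closed A.
Proof. exact: compact_closed. Qed.

Lemma continuous_bounded_compact (f : Y -> R) : continuous f ->
  exists2 M : R, 0 < M & forall x, `|f x| <= M.
Proof.
move=> cf; have : compact (f @` setT).
  by apply: continuous_compact cY; exact: continuous_subspaceT.
move=> /compact_bounded[M [Mreal fM]].
exists (`|M| + 1); first by rewrite ltr_pwDr.
move=> x; apply: fM; last by exists x.
by rewrite ltr_pwDr// ler_norm.
Qed.

Lemma open_borel (V : set Y) : open V -> measurable (V : set (borel Y)).
Proof. by move=> oV; exact: sub_sigma_algebra. Qed.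

Lemma closed_borel (A : set Y) : closed A -> measurable (A : set (borel Y)).
Proof.
move=> clA; rewrite -[A]setCK; apply: measurableC; apply: open_borel.
exact: closed_openC.
Qed.

Lemma continuous_borel (f : Y -> R) : continuous f ->
  measurable_fun [set: borel Y] f.
Proof.
move=> cf; apply: (measurability _ (RGenOpens.measurableE R)).
move=> _ [_ [a [b ->]] <-].
rewrite setTI; apply: open_borel; by apply: open_comp => //.
Qed.

Lemma bounded_integrable (d : measure_display) (T : measurableType d)
    (mu : probability T R) (f : T -> R) (M : R) :
  measurable_fun [set: T] f -> (forall x, `|f x| <= M) ->
  mu.-integrable [set: T] (EFin \o f).
Proof.
move=> mf fM; apply: measurable_bounded_integrable => //.
  by rewrite ltey_eq fin_num_measure.
exists M; split; rewrite ?num_real // => x Mx y _ /=.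
exact: le_trans (fM y) (ltW Mx).
Qed.

Lemma continuous_integrable (mu : probability (borel Y) R) (f : Y -> R) :
  continuous f -> mu.-integrable [set: borel Y] (EFin \o f).
Proof.
move=> cf; have [M M0 fM] := continuous_bounded_compact cf.
exact: bounded_integrable (continuous_borel cf) fM.
Qed.

Lemma probability_fineK (mu : probability (borel Y) R) (B : set (borel Y)) :
  measurable B -> (fine (mu B))%:E = mu B.
Proof. by move=> mB; rewrite fineK// fin_num_measure. Qed.

(** In a compact space complements of open sets are compact, so that outer
    approximation of the complement gives inner approximation of a set. *)
Lemma regular_approx (mu : probability (borel Y) R) :
  (forall B : set (borel Y), measurable B -> forall e : R, 0 < e ->
    exists V : set Y, [/\ open V, B `<=` V & (mu V <= mu B + e%:E)%E]) ->
  regular_measure mu.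
Proof.
move=> outer B mB; split; apply/eqP; rewrite eq_le; apply/andP; split.
- apply: le_ereal_inf_tmp => _ [V [oV BV] <-].
  by apply: le_measure => //; rewrite inE//; exact: open_borel.
- apply/lee_addgt0Pr => e e0; have [V [oV BV muV]] := outer B mB e e0.
  by apply: le_trans muV; apply: ereal_inf_lbound; exists V.
- apply/lee_addgt0Pr => e e0.
  have [V [oV BV muV]] := outer _ (measurableC mB) e e0.
  have KB : ~` V `<=` B by rewrite -[B]setCK; exact: subsetC.
  have cK : compact (~` V) by apply: closed_compact_space; exact: open_closedC.
  apply: (@le_trans _ _ (mu (~` V) + e%:E)%E); last first.
    by apply: leeD2r; apply: ereal_sup_ubound; exists (~` V).
  have mV := open_borel oV.
  move: muV; rewrite probability_setC// probability_setC//.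
  rewrite -(probability_fineK mu mV) -(probability_fineK mu mB).
  by rewrite -!EFinB -!EFinD !lee_fin => ?; lra.
- apply: ge_ereal_sup => _ [K [cK KB] <-].
  apply: le_measure => //; rewrite inE//; apply: closed_borel.
  exact: compact_closed_space.
Qed.

Lemma regular_outer (mu : probability (borel Y) R) (B : set (borel Y)) (e : R) :
  regular_measure mu -> measurable B -> 0 < e ->
  exists V : set Y, [/\ open V, B `<=` V & (mu V <= mu B + e%:E)%E].
Proof.
move=> rmu mB e0; have [muE _] := rmu B mB.
have : ereal_inf [set mu V | V in [set V : set Y | open V /\ B `<=` V]]
    \is a fin_num.
  by rewrite -muE fin_num_measure.
move=> /(lb_ereal_inf_adherent e0)[_ [V [oV BV] <-] muV].
by exists V; split => //; rewrite muE ltW.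
Qed.

Lemma regular_inner (mu : probability (borel Y) R) (B : set (borel Y)) (e : R) :
  regular_measure mu -> measurable B -> 0 < e ->
  exists K : set Y, [/\ compact K, K `<=` B & (mu B <= mu K + e%:E)%E].
Proof.
move=> rmu mB e0; have [V [oV BV muV]] := regular_outer rmu (measurableC mB) e0.
exists (~` V); split.
- by apply: closed_compact_space; exact: open_closedC.
- by rewrite -[B]setCK; exact: subsetC.
have mV := open_borel oV.
move: muV; rewrite probability_setC// probability_setC//.
rewrite -(probability_fineK mu mV) -(probability_fineK mu mB).
by rewrite -!EFinB -!EFinD !lee_fin => ?; lra.
Qed.

End CompactHausdorff.

(** * The Riesz-Markov representation theorem *)

Section Riesz.
Variables (R : realType) (Y : ptopologicalType).
Hypotheses (hY : hausdorff_space Y) (cY : compact [set: Y]).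
Variable Lam : (Y -> R) -> R.

Definition positive_functional : Prop :=
  [/\ forall f g : Y -> R, continuous f -> continuous g ->
        Lam (fun x => f x + g x) = Lam f + Lam g,
      forall (c : R) (f : Y -> R), continuous f ->
        Lam (fun x => c * f x) = c * Lam f,
      forall f : Y -> R, continuous f -> (forall x, 0 <= f x) -> 0 <= Lam f &
      Lam (fun=> 1) = 1].

Hypothesis HLam : positive_functional.

Let Ladd (f g : Y -> R) : continuous f -> continuous g ->
  Lam (fun x => f x + g x) = Lam f + Lam g.
Proof. by have [+ _ _ _] := HLam; exact. Qed.

Let Lscale (c : R) (f : Y -> R) : continuous f ->
  Lam (fun x => c * f x) = c * Lam f.
Proof. by have [_ + _ _] := HLam; exact. Qed.

Let Lpos (f : Y -> R) : continuous f -> (forall x, 0 <= f x) -> 0 <= Lam f.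
Proof. by have [_ _ + _] := HLam; exact. Qed.

Let L1 : Lam (fun=> 1) = 1.
Proof. by have [_ _ _] := HLam. Qed.

Let ccst (c : R) : continuous (fun _ : Y => c).
Proof. exact: cst_continuous. Qed.

Let cadd (f g : Y -> R) : continuous f -> continuous g ->
  continuous (fun x => f x + g x).
Proof. by move=> cf cg x; apply: cvgD; [exact: cf | exact: cg]. Qed.

Let csub (f g : Y -> R) : continuous f -> continuous g ->
  continuous (fun x => f x - g x).
Proof. by move=> cf cg x; apply: cvgB; [exact: cf | exact: cg]. Qed.

Let cmul (f g : Y -> R) : continuous f -> continuous g ->
  continuous (fun x => f x * g x).
Proof. by move=> cf cg x; apply: cvgM; [exact: cf | exact: cg]. Qed.

Let cmax (f g : Y -> R) : continuous f -> continuous g ->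
  continuous (fun x => Num.max (f x) (g x)).
Proof. by move=> cf cg x; apply: continuous_max; [exact: cf | exact: cg]. Qed.

Let cmin (f g : Y -> R) : continuous f -> continuous g ->
  continuous (fun x => Num.min (f x) (g x)).
Proof. by move=> cf cg x; apply: continuous_min; [exact: cf | exact: cg]. Qed.

Let Lsub (f g : Y -> R) : continuous f -> continuous g ->
  Lam (fun x => f x - g x) = Lam f - Lam g.
Proof.
move=> cf cg; have -> : (fun x => f x - g x) = (fun x => f x + (-1) * g x).
  by apply/funext => x; rewrite mulN1r.
by rewrite Ladd// ?Lscale// ?mulN1r//; apply: cmul.
Qed.

Let Lle (f g : Y -> R) : continuous f -> continuous g ->
  (forall x, f x <= g x) -> Lam f <= Lam g.
Proof.
move=> cf cg fg; rewrite -subr_ge0 -Lsub//; apply: Lpos; first exact: csub.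
by move=> x; rewrite subr_ge0.
Qed.

Let Lcst (c : R) : Lam (fun=> c) = c.
Proof.
have -> : (fun=> c) = (fun _ : Y => c * 1) by apply/funext => x; rewrite mulr1.
by rewrite Lscale// L1 mulr1.
Qed.

Definition below (V : set Y) (f : Y -> R) : Prop :=
  [/\ continuous f, forall x, 0 <= f x <= 1 & forall x, ~ V x -> f x = 0].

(** The functions are not required to have their support inside [V]: replacing
    [f] by [cut e f] below achieves this at the cost of [e], so the supremum is
    the usual one. *)
Definition riesz_open (V : set Y) : \bar R :=
  ereal_sup [set (Lam f)%:E | f in below V].

Definition riesz_outer (A : set Y) : \bar R :=
  ereal_inf [set riesz_open V | V in [set V | open V /\ A `<=` V]].

Let below0 V : below V (fun=> 0).
Proof. by split => // x; rewrite lexx ler01. Qed.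

Lemma riesz_open_ge0 V : (0 <= riesz_open V)%E.
Proof.
apply: ereal_sup_ubound; exists (fun=> 0); first exact: below0.
by rewrite Lcst.
Qed.

Lemma riesz_open_le1 V : (riesz_open V <= 1)%E.
Proof.
apply: ge_ereal_sup => _ [f [cf f01 _] <-]; rewrite lee_fin -[leRHS]L1.
by apply: Lle => // x; case/andP: (f01 x).
Qed.

Lemma riesz_open_fin V : riesz_open V \is a fin_num.
Proof.
rewrite ge0_fin_numE ?riesz_open_ge0//.
by rewrite (le_lt_trans (riesz_open_le1 V))// ltey.
Qed.

Lemma le_riesz_open V W : V `<=` W -> (riesz_open V <= riesz_open W)%E.
Proof.
move=> VW; apply: ge_ereal_sup => _ [f [cf f01 f0] <-].
by apply: ereal_sup_ubound; exists f => //; split => // x nW; apply: f0 => /VW.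
Qed.

(** If [f] is [below V], then [cut e f] vanishes off the compact subset
    [[set x | e <= f x]] of [V]. *)
Let cut (e : R) (f : Y -> R) : Y -> R := fun x => Num.max (f x - e) 0.

Let cut_below V e f : 0 <= e -> below V f -> below V (cut e f).
Proof.
move=> e0 [cf f01 f0]; split.
- by apply: cmax => //; apply: csub.
- move=> x; have /andP[fx0 fx1] := f01 x; rewrite /cut le_max lexx orbT /=.
  by rewrite ge_max ler01 andbT; lra.
- by move=> x /f0 fx; rewrite /cut fx sub0r; apply: max_r; rewrite oppr_le0.
Qed.

Let Lam_cut V e f : below V f -> Lam f <= Lam (cut e f) + e.
Proof.
move=> [cf _ _]; have ccut : continuous (cut e f).
  by apply: cmax => //; apply: csub.
rewrite -[X in _ + X]Lcst -Ladd//; apply: Lle => //; first exact: cadd.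
by move=> x; rewrite -lerBlDr /cut le_max lexx.
Qed.

Let closed_level e (f : Y -> R) : continuous f -> closed [set x | e <= f x].
Proof.
by move=> cf; apply: (@closed_comp _ _ f [set y | e <= y]) => //;
  exact: closed_ge.
Qed.

(** A function [f] below the union is, up to [e], a sum of functions below [V] and
    below [W], obtained from an Urysohn function [h] equal to 1 on the part of
    the compact level set [e <= f] outside [W], and to 0 off [V]. *)
Lemma riesz_openU V W : open V -> open W ->
  (riesz_open (V `|` W) <= riesz_open V + riesz_open W)%E.
Proof.
move=> oV oW; apply: ge_ereal_sup => _ [f bf <-].
apply/lee_addgt0Pr => e e0; have [cf f01 f0] := bf.
have clK : closed ([set x | e <= f x] `\` W).
  by rewrite setDE; apply: closedI; [exact: closed_level | exact: open_closedC].
have [h [ch h01 h0 h1]] : exists h : Y -> R, [/\ continuous h,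
    forall x, 0 <= h x <= 1, forall x, (~` V) x -> h x = 0 &
    forall x, ([set x | e <= f x] `\` W) x -> h x = 1].
  apply: (continuous_separation R hY cY) => //; first exact: open_closedC.
  rewrite -subset0 => x [nVx [/= fx nWx]]; have : ~ (V `|` W) x by case.
  by move=> /f0 fx0; rewrite fx0 leNgt e0 in fx.
have ccut : continuous (cut e f) by apply: cmax => //; apply: csub.
pose f1 x := f x * h x; pose f2 x := cut e f x * (1 - h x).
have cf1 : continuous f1 by exact: cmul.
have cf2 : continuous f2 by apply: cmul => //; apply: csub.
have b1 : below V f1.
  split => // x.
    have /andP[? ?] := f01 x; have /andP[? ?] := h01 x.
    by rewrite /f1 mulr_ge0//= mulr_ile1.
  by move=> /h0; rewrite /f1 => ->; rewrite mulr0.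
have b2 : below W f2.
  have [_ c01 _] := cut_below (ltW e0) bf.
  split => // x.
    have /andP[? ?] := c01 x; have /andP[? ?] := h01 x.
    by rewrite /f2 mulr_ge0//= ?mulr_ile1//; lra.
  move=> nWx; rewrite /f2; have [fx|fx] := leP e (f x).
    by rewrite h1 ?subrr ?mulr0.
  by rewrite /cut max_r ?mul0r// subr_le0 ltW.
apply: (@le_trans _ _ ((Lam f1)%:E + (Lam f2)%:E + e%:E)%E); last first.
  by apply: leeD2r; apply: leeD; apply: ereal_sup_ubound;
    [exists f1 | exists f2].
rewrite -!EFinD lee_fin -[X in _ + X]Lcst -Ladd// -Ladd//; last exact: cadd.
apply: Lle => //; first by apply: cadd => //; exact: cadd.
move=> x; have /andP[? ?] := h01 x.
have : f x - e <= cut e f x by rewrite /cut le_max lexx.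
have : 0 <= cut e f x by rewrite /cut le_max lexx orbT.
by rewrite /f1 /f2; nra.
Qed.

Lemma riesz_open0 : riesz_open set0 = 0%E.
Proof.
apply/eqP; rewrite eq_le riesz_open_ge0 andbT.
apply: ge_ereal_sup => _ [f [cf f01 f0] <-].
rewrite (_ : f = fun=> 0) ?Lcst//.
by apply/funext => x; apply: f0.
Qed.

Lemma riesz_openT : riesz_open setT = 1%E.
Proof.
apply/eqP; rewrite eq_le riesz_open_le1 /=.
apply: ereal_sup_ubound; exists (fun=> 1); last by rewrite L1.
by split => // x; rewrite ?lexx ?ler01// => /(_ I).
Qed.

Lemma riesz_open_bigsetU (V : nat -> set Y) n : (forall k, open (V k)) ->
  (riesz_open (\bigcup_(k < n) V k) <= \sum_(0 <= k < n) riesz_open (V k))%E.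
Proof.
move=> oV; elim: n => [|n IH].
  by rewrite big_geq// II0 bigcup_set0 riesz_open0.
rewrite big_nat_recr//= bigcup_mkord big_ord_recr/= -bigcup_mkord.
apply: le_trans (riesz_openU _ _) _ => //; last exact: leeD2r.
by apply: bigcup_open => k _.
Qed.

(** By compactness the level set [e <= f] is covered by finitely many [V k], and
    [cut e f] is below their union. *)
Lemma riesz_open_sigma (V : nat -> set Y) : (forall k, open (V k)) ->
  (riesz_open (\bigcup_k V k) <= \sum_(k <oo) riesz_open (V k))%E.
Proof.
move=> oV; apply: ge_ereal_sup => _ [f bf <-].
apply/lee_addgt0Pr => e e0; have [cf f01 f0] := bf.
have cK : compact [set x | e <= f x].
  by apply: closed_compact_space => //; exact: closed_level.
have KV : [set x | e <= f x] `<=` \bigcup_(k in setT) V k.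
  move=> x /= fx; apply: contrapT => /f0 fx0.
  by rewrite fx0 leNgt e0 in fx.
move: cK; rewrite compact_cover => cK.
have [J _ KJ] := cK nat setT V (fun k _ => oV k) KV.
pose n := (\max_(k <- finmap.enum_fset J) k.+1)%N.
have bn : below (\bigcup_(k < n) V k) (cut e f).
  have [cc c01 _] := cut_below (ltW e0) bf; split => // x nx.
  rewrite /cut max_r// subr_le0 leNgt; apply/negP => /ltW /KJ[k /= kJ Vk].
  apply: nx; exists k => //=.
  exact: (@leq_bigmax_seq _ (finmap.enum_fset J) xpredT (fun k => k.+1) k).
apply: (@le_trans _ _ ((Lam (cut e f))%:E + e%:E)%E).
  by rewrite -EFinD lee_fin; exact: Lam_cut bf.
apply: leeD2r; apply: (@le_trans _ _ (riesz_open (\bigcup_(k < n) V k))).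
  by apply: ereal_sup_ubound; exists (cut e f).
apply: le_trans (riesz_open_bigsetU n oV) _.
by apply: nneseries_lim_ge => k _ _; exact: riesz_open_ge0.
Qed.

Lemma riesz_outer_ge0 A : (0 <= riesz_outer A)%E.
Proof. by apply: le_ereal_inf_tmp => _ [V _ <-]; exact: riesz_open_ge0. Qed.

Lemma le_riesz_outer A B : A `<=` B -> (riesz_outer A <= riesz_outer B)%E.
Proof.
move=> AB; apply: ereal_inf_le_tmp => _ [V [oV BV] <-].
by exists V => //; split => //; exact: (subset_trans AB BV).
Qed.

Lemma riesz_outer_open V : open V -> riesz_outer V = riesz_open V.
Proof.
move=> oV; apply/eqP; rewrite eq_le; apply/andP; split.
  by apply: ereal_inf_lbound; exists V => //; split => //; exact: subset_refl.
by apply: le_ereal_inf_tmp => _ [W [oW VW] <-]; exact: le_riesz_open.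
Qed.

Lemma riesz_outer_fin A : riesz_outer A \is a fin_num.
Proof.
rewrite ge0_fin_numE ?riesz_outer_ge0//.
apply: le_lt_trans (le_riesz_outer (@subsetT _ A)) _.
by rewrite riesz_outer_open ?riesz_openT ?ltey//; exact: openT.
Qed.

Lemma riesz_outer_approx A (e : R) : 0 < e ->
  exists V, [/\ open V, A `<=` V & (riesz_open V <= riesz_outer A + e%:E)%E].
Proof.
move=> e0; have [_ [V [oV AV] <-] Ve] :=
  lb_ereal_inf_adherent e0 (riesz_outer_fin A).
by exists V; split => //; exact: ltW.
Qed.

Lemma riesz_outer0 : riesz_outer set0 = 0%E.
Proof. by rewrite riesz_outer_open ?riesz_open0//; exact: open0. Qed.

Lemma riesz_outer_sigma_subadditive : sigma_subadditive riesz_outer.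
Proof.
move=> A; apply/lee_addgt0Pr => e e0.
rewrite (le_trans _ (epsilon_trick _ _ _))//; last 2 first.
- by move=> n; exact: riesz_outer_ge0.
- exact: ltW.
have en0 n : 0 < e / (2 ^ n.+1)%:R by rewrite divr_gt0// ltr0n expn_gt0.
have /choice[V PV] n := riesz_outer_approx (A n) (en0 n).
have oV n : open (V n) by have [] := PV n.
apply: (@le_trans _ _ (riesz_open (\bigcup_n V n))).
  apply: ereal_inf_lbound; exists (\bigcup_n V n) => //; split.
    exact: bigcup_open.
  by apply: subset_bigcup => n _; have [] := PV n.
apply: le_trans (riesz_open_sigma oV) _.
apply: lee_nneseries => [n _ _|n _]; first exact: riesz_open_ge0.
by have [] := PV n.
Qed.

Lemma riesz_open_approx V (e : R) : 0 < e ->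
  exists2 f, below V f & (riesz_open V <= (Lam f)%:E + e%:E)%E.
Proof.
move=> e0; have [_ [f bf <-]] := ub_ereal_sup_adherent e0 (riesz_open_fin V).
by rewrite lteBlDr// => /ltW; exists f.
Qed.

(** For [W] open containing [X] take [f'] below [W `&` V], nearly optimal and
    vanishing off a compact [K], and [g] below [W `\` K], nearly optimal: their
    sum is below [W], and [W `\` K] contains [X `\` V]. The four approximations
    cost [e / 4] each. *)
Lemma riesz_open_caratheodory V : open V ->
  caratheodory_measurable riesz_outer V.
Proof.
move=> oV.
pose mu : {outer_measure set Y -> \bar R} := HB.pack riesz_outer
  (isOuterMeasure.Build R Y riesz_outer riesz_outer0 riesz_outer_ge0
    le_riesz_outer riesz_outer_sigma_subadditive).
apply: (@le_caratheodory_measurable R Y mu V) => X /=.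
apply/lee_addgt0Pr => e e0.
have e4 : 0 < e / 4 by rewrite divr_gt0.
have [W [oW XW We]] := riesz_outer_approx X e4.
have oVW : open (W `&` V) by exact: openI.
have [f bf fVW] := riesz_open_approx (W `&` V) e4.
pose f' := cut (e / 4) f; have bf' := cut_below (ltW e4) bf.
have [cf f01 f0] := bf; have [cf' f'01 f'0] := bf'.
pose K := [set x | e / 4 <= f x].
have oK : open (W `&` ~` K).
  by apply: openI => //; apply: closed_openC; exact: closed_level.
have [g bg gWK] := riesz_open_approx (W `&` ~` K) e4.
have [cg g01 g0] := bg.
have bfg : below W (fun x => f' x + g x).
  split; first exact: cadd.
    move=> x; have /andP[? ?] := f'01 x; have /andP[? ?] := g01 x.
    have [fx|fx] := leP (e / 4) (f x).
      have -> : g x = 0 by apply: g0 => -[_]; apply.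
      by rewrite addr0 f'01.
    have -> : f' x = 0 by rewrite /f' /cut max_r// subr_le0 ltW.
    by rewrite add0r g01.
  move=> x nWx; have -> : f' x = 0 by apply: f'0 => -[].
  by have -> : g x = 0; rewrite ?addr0//; apply: g0 => -[].
have Lfg : ((Lam f')%:E + (Lam g)%:E <= riesz_open W)%E.
  rewrite -EFinD -Ladd//; apply: ereal_sup_ubound.
  by exists (fun x => f' x + g x).
have Lff' : Lam f <= Lam f' + e / 4 by exact: Lam_cut bf.
have XV : (riesz_outer (X `&` V) <= riesz_open (W `&` V))%E.
  rewrite -(riesz_outer_open oVW); apply: le_riesz_outer; exact: setSI.
have XnV : (riesz_outer (X `&` ~` V) <= riesz_open (W `&` ~` K))%E.
  rewrite -(riesz_outer_open oK); apply: le_riesz_outer => x [Xx nVx].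
  split; first exact: XW.
  rewrite /K /= => fx; have fx0 : f x = 0 by apply: f0 => -[].
  by rewrite fx0 leNgt e4 in fx.
move: We fVW gWK Lfg XV XnV.
rewrite -(fineK (riesz_outer_fin X)) -(fineK (riesz_outer_fin (X `&` V))).
rewrite -(fineK (riesz_outer_fin (X `&` ~` V))) -(fineK (riesz_open_fin W)).
rewrite -(fineK (riesz_open_fin (W `&` V))).
rewrite -(fineK (riesz_open_fin (W `&` ~` K))).
by rewrite -!EFinD !lee_fin => *; lra.
Qed.

Lemma borel_caratheodory (A : set (borel Y)) : measurable A ->
  caratheodory_measurable riesz_outer A.
Proof.
pose mu : {outer_measure set Y -> \bar R} := HB.pack riesz_outer
  (isOuterMeasure.Build R Y riesz_outer riesz_outer0 riesz_outer_ge0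
    le_riesz_outer riesz_outer_sigma_subadditive).
move=> mA; apply: (mA (caratheodory_measurable mu)); split.
  split.
  - exact: caratheodory_measurable_set0.
  - by move=> B mB; rewrite setTD; exact: caratheodory_measurable_setC.
  - by move=> F mF; exact: caratheodory_measurable_bigcup.
by move=> V; exact: riesz_open_caratheodory.
Qed.

Lemma riesz_outer_sigma_additive :
  semi_sigma_additive (riesz_outer : set (borel Y) -> \bar R).
Proof.
pose mu : {outer_measure set Y -> \bar R} := HB.pack riesz_outer
  (isOuterMeasure.Build R Y riesz_outer riesz_outer0 riesz_outer_ge0
    le_riesz_outer riesz_outer_sigma_subadditive).
move=> F mF tF mUF.
apply: (@caratheodory_measure_sigma_additive R Y mu) => //.
  by move=> i; exact: borel_caratheodory.
exact: borel_caratheodory.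
Qed.

Lemma riesz_outerT : riesz_outer setT = 1%E.
Proof. by rewrite riesz_outer_open ?riesz_openT//; exact: openT. Qed.

Lemma riesz_probability : exists2 mu : probability (borel Y) R,
  regular_measure mu & forall V : set Y, open V -> mu V = riesz_open V.
Proof.
pose mu0 : set (borel Y) -> \bar R := riesz_outer.
pose m : {measure set (borel Y) -> \bar R} := HB.pack mu0
  (isMeasure.Build _ (borel Y) R mu0 riesz_outer0 riesz_outer_ge0
    riesz_outer_sigma_additive).
pose mu : probability (borel Y) R := HB.pack (Measure.sort m)
  (Measure_isProbability.Build _ (borel Y) R m riesz_outerT).
exists mu; last exact: riesz_outer_open.
apply: regular_approx => // B mB e e0.
have [V [oV BV Ve]] := riesz_outer_approx B e0.
exists V; split => //.
by rewrite [leLHS]riesz_outer_open.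
Qed.

Section Representation.
Variable mu : probability (borel Y) R.
Hypothesis mu_open : forall V : set Y, open V -> mu V = riesz_open V.

Let integ (f : Y -> R) : R := \int[mu]_x f x.

Let integD (f g : Y -> R) : continuous f -> continuous g ->
  integ (fun x => f x + g x) = integ f + integ g.
Proof.
by move=> cf cg; apply: RintegralD => //; exact: continuous_integrable.
Qed.

Let integB (f g : Y -> R) : continuous f -> continuous g ->
  integ (fun x => f x - g x) = integ f - integ g.
Proof.
by move=> cf cg; apply: RintegralB => //; exact: continuous_integrable.
Qed.

Let integ_cst (c : R) : integ (fun=> c) = c.
Proof.
rewrite /integ Rintegral_cst// -[RHS]mulr1; congr (_ * _).
exact: (congr1 fine (probability_setT mu)).
Qed.

Let open_level (f : Y -> R) (t : R) : continuous f -> open [set x | t < f x].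
Proof.
by move=> cf; apply: (@open_comp _ _ f [set y | t < y]) => //; exact: open_gt.
Qed.

(** The layer [g] of [f] between the heights [s] and [s + d] satisfies
    [d * \1_{s + d < f} <= g <= d * \1_{s < f}]. The left inequality bounds the
    integral of [g] from below, the right one bounds [Lam g] from above. *)
Lemma riesz_layer (f g : Y -> R) (s d : R) : continuous f -> 0 < d ->
  g = (fun x => Num.min (f x) (s + d) - Num.min (f x) s) ->
  Lam g + d * fine (mu [set x | s + d < f x])
    <= integ g + d * fine (mu [set x | s < f x]).
Proof.
move=> cf d0 gE.
have cg : continuous g by rewrite gE; apply: csub; apply: cmin.
have g0 x : 0 <= g x.
  by rewrite gE subr_ge0 le_min !ge_min lexx /= lerDl (ltW d0) !orbT.
have gd x : g x <= d.
  by rewrite gE; case: (leP (f x) s); case: (leP (f x) (s + d)); lra.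
apply: (@le_trans _ _ (d * fine (mu [set x | s < f x])
    + d * fine (mu [set x | s + d < f x]))).
  apply: lerD => //.
  have oV := open_level s cf.
  rewrite -ler_pdivrMl// -Lscale// -lee_fin.
  rewrite (probability_fineK mu (open_borel oV)) mu_open//.
  apply: ereal_sup_ubound; exists (fun x => d^-1 * g x) => //.
  split; first exact: cmul.
    move=> x; rewrite mulr_ge0 ?invr_ge0 ?(ltW d0)//=.
    by rewrite ler_pdivrMl// mulr1.
  move=> x /negP; rewrite -leNgt => fs.
  have fsd : f x <= s + d by rewrite (le_trans fs)// lerDl ltW.
  by rewrite gE !min_l// subrr mulr0.
rewrite addrC; apply: lerD => //.
have oV := open_level (s + d) cf.
rewrite -ler_pdivlMl//.
have mV := open_borel oV.
rewrite (_ : fine _ = \int[mu]_x (\1_([set x | s + d < f x]) x)); last first.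
  by rewrite /Rintegral integral_indic// setIT.
rewrite /integ -RintegralZl//; last exact: continuous_integrable.
apply: le_Rintegral => //.
- apply: (@bounded_integrable R _ _ mu _ 1) => //.
  by move=> x; rewrite indicE; case: (_ \in _); rewrite ?normr0 ?normr1.
- by apply: continuous_integrable => //; exact: cmul.
move=> x _; rewrite indicE; case: (boolP (_ \in _)) => [/set_mem /= fx|_].
  have -> : g x = d.
    by rewrite gE !min_r ?ltW//; [lra | apply: lt_trans fx; rewrite ltrDl].
  by rewrite mulVf// gt_eqF.
by rewrite mulr_ge0 ?invr_ge0 ?(ltW d0).
Qed.

(** Cut [f] into [n.+1] layers of height [d]. Summing the estimates of
    [riesz_layer], the measures of the level sets telescope and the total error
    is at most [d]. *)
Lemma riesz_le_integral (f : Y -> R) : continuous f ->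
  (forall x, 0 <= f x <= 1) -> Lam f <= integ f.
Proof.
move=> cf f01; apply/ler_addgt0Pr => e e0.
have [n ne] : exists n : nat, n.+1%:R^-1 < e.
  have [n _ nP] := near_infty_natSinv_lt (PosNum e0).
  by exists n; apply: nP => /=.
pose d : R := n.+1%:R^-1; have d0 : 0 < d by rewrite invr_gt0.
pose p m := fine (mu [set x | m%:R * d < f x]).
have p01 m : 0 <= p m <= 1.
  have mV : measurable ([set x | m%:R * d < f x] : set (borel Y)).
    by apply: open_borel; exact: open_level.
  rewrite -lee_fin -[(_ <= 1)%R]lee_fin /p fineK ?fin_num_measure//.
  by rewrite measure_ge0 probability_le1.
have key m : Lam (fun x => Num.min (f x) (m%:R * d)) + d * p m
    <= integ (fun x => Num.min (f x) (m%:R * d)) + d * p 0%N.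
  elim: m => [|m IH].
    rewrite (_ : (fun x => _) = fun=> 0) ?Lcst ?integ_cst//.
    by apply/funext => x; rewrite mul0r; apply: min_r; case/andP: (f01 x).
  have ck (k : nat) : continuous (fun x => Num.min (f x) (k%:R * d)).
    exact: cmin.
  have := riesz_layer cf d0 (erefl (fun x =>
    Num.min (f x) (m%:R * d + d) - Num.min (f x) (m%:R * d))).
  rewrite /= (_ : m%:R * d + d = m.+1%:R * d); last first.
    by rewrite -natr1 mulrDl mul1r.
  rewrite Lsub// integB// -/(p m) -/(p m.+1); move: IH; lra.
have := key n.+1; rewrite (_ : n.+1%:R * d = 1) ?mulfV//.
rewrite (_ : (fun x => Num.min (f x) 1) = f); last first.
  by apply/funext => x; apply: min_l; case/andP: (f01 x).
have /andP[q0 _] := p01 n.+1; have /andP[_ q1] := p01 0%N.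
have := mulr_ge0 (ltW d0) q0; have : d * p 0%N <= d by rewrite ler_piMr// ltW.
by rewrite -/d in ne; lra.
Qed.

(** Applying [riesz_le_integral] to [f] and to [1 - f] gives equality for
    functions with values in [[0, 1]], and the general case follows by an affine
    change of scale. *)
Lemma riesz_integral (f : Y -> R) : continuous f -> \int[mu]_x f x = Lam f.
Proof.
have unitE (g : Y -> R) : continuous g -> (forall x, 0 <= g x <= 1) ->
    integ g = Lam g.
  move=> cg g01; apply/eqP; rewrite eq_le riesz_le_integral// andbT.
  have := @riesz_le_integral (fun x => 1 - g x).
  rewrite Lsub// integB// L1 integ_cst => H.
  rewrite -(@lerD2l _ (-1)) -lerN2 !opprD opprK; apply: H; first exact: csub.
  by move=> x; have := g01 x; lra.
move=> cf; have [M M0 fM] := continuous_bounded_compact cY cf.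
pose c : R := (M + M)^-1; have c0 : 0 < c by rewrite invr_gt0 addr_gt0.
have cg : continuous (fun x => c * (f x + M)) by apply: cmul => //; exact: cadd.
have g01 x : 0 <= c * (f x + M) <= 1.
  have /ler_normlP[fM1 fM2] := fM x; rewrite mulr_ge0 ?(ltW c0)//=; last lra.
  by rewrite ler_pdivrMl ?addr_gt0// mulr1; lra.
have cfM : continuous (fun x => f x + M) by exact: cadd.
have := unitE _ cg g01; rewrite Lscale// Ladd// Lcst.
have -> : integ (fun x => c * (f x + M)) = c * (integ f + M).
  rewrite -[X in _ = c * (_ + X)]integ_cst -integD//.
  by apply: RintegralZl => //; exact: continuous_integrable.
by move/(mulfI (lt0r_neq0 c0))/addIr.
Qed.
End Representation.

Theorem riesz_markov : exists mu : reg_prob R Y,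
  forall f : Y -> R, continuous f -> \int[val mu]_x f x = Lam f.
Proof.
have [mu rmu mu_open] := riesz_probability.
have rmu' : `[< regular_measure mu >] by exact/asboolP.
exists (exist _ mu rmu') => f cf; exact: riesz_integral.
Qed.

End Riesz.

(** * Weak-* compactness of the regular probability measures *)

Section RegularMeasures.
Variables (R : realType) (Y : ptopologicalType).
Hypotheses (hY : hausdorff_space Y) (cY : compact [set: Y]).

Lemma reg_probP (mu : reg_prob R Y) : regular_measure (val mu).
Proof. exact/asboolP/(valP mu). Qed.

Lemma le_integral_open (mu : probability (borel Y) R) (h : Y -> R) (V : set Y) :
  continuous h -> open V -> (forall x, h x <= \1_V x) ->
  \int[mu]_x h x <= fine (mu V).
Proof.
move=> ch oV hV; have mV := open_borel oV.
rewrite [leRHS](_ : _ = \int[mu]_x (\1_V x)); last first.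
  by rewrite /Rintegral integral_indic// setIT.
apply: le_Rintegral => //; first exact: continuous_integrable.
apply: (@bounded_integrable R _ _ mu _ 1) => //.
by move=> x; rewrite indicE; case: (_ \in _); rewrite ?normr0 ?normr1.
Qed.

Lemma le_closed_integral (mu : probability (borel Y) R) (h : Y -> R)
    (K : set Y) :
  continuous h -> closed K -> (forall x, \1_K x <= h x) ->
  fine (mu K) <= \int[mu]_x h x.
Proof.
move=> ch clK hK; have mK := closed_borel clK.
rewrite [leLHS](_ : _ = \int[mu]_x (\1_K x)); last first.
  by rewrite /Rintegral integral_indic// setIT.
apply: le_Rintegral => //; last exact: continuous_integrable.
apply: (@bounded_integrable R _ _ mu _ 1) => //.
by move=> x; rewrite indicE; case: (_ \in _); rewrite ?normr0 ?normr1.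
Qed.

(** Enclose [B] between a compact [K] on which [mu] is nearly [mu B] and an open
    [V] on which [nu] is nearly [nu B], and integrate an Urysohn function between
    [K] and [V]. *)
Lemma regular_le_of_integrals (mu nu : probability (borel Y) R) :
  regular_measure mu -> regular_measure nu ->
  (forall f : Y -> R, continuous f -> \int[mu]_x f x = \int[nu]_x f x) ->
  forall B : set (borel Y), measurable B -> (mu B <= nu B)%E.
Proof.
move=> rmu rnu E B mB; apply/lee_addgt0Pr => e e0.
have e2 : 0 < e / 2 by rewrite divr_gt0.
have [K [cK KB muK]] := regular_inner cY rmu mB e2.
have [V [oV BV nuV]] := regular_outer rnu mB e2.
have clK := compact_closed_space hY cK.
have [h [ch h01 h0 h1]] : exists h : Y -> R, [/\ continuous h,
    forall x, 0 <= h x <= 1, forall x, (~` V) x -> h x = 0 &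
    forall x, K x -> h x = 1].
  apply: (continuous_separation R hY cY) => //; first exact: open_closedC.
  by rewrite -subset0 => x [nVx /KB/BV].
have Kh : fine (mu K) <= \int[mu]_x h x.
  apply: le_closed_integral => // x; rewrite indicE.
  by case: (boolP (_ \in _)) => [/set_mem/h1 ->//|_]; case/andP: (h01 x).
have hV : \int[nu]_x h x <= fine (nu V).
  apply: le_integral_open => // x; rewrite indicE.
  case: (boolP (x \in V)) => [_|nVx]; first by case/andP: (h01 x).
  by rewrite h0//= => Vx; move: nVx; rewrite notin_setE; apply.
move: muK nuV; rewrite -(probability_fineK mu (closed_borel clK)).
rewrite -(probability_fineK nu (open_borel oV)).
rewrite -(probability_fineK mu mB) -(probability_fineK nu mB).
by rewrite -!EFinD !lee_fin; rewrite (E h ch) in Kh; lra.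
Qed.

Lemma regular_eq_of_integrals (mu nu : probability (borel Y) R) :
  regular_measure mu -> regular_measure nu ->
  (forall f : Y -> R, continuous f -> \int[mu]_x f x = \int[nu]_x f x) ->
  forall B : set (borel Y), measurable B -> mu B = nu B.
Proof.
move=> rmu rnu E B mB; apply/eqP; rewrite eq_le; apply/andP.
by split; apply: regular_le_of_integrals => // f cf; rewrite E.
Qed.

Lemma Rintegral_bound (d : measure_display) (T : measurableType d)
    (mu : probability T R) (f : T -> R) (M : R) :
  measurable_fun [set: T] f -> (forall x, `|f x| <= M) ->
  `|\int[mu]_x f x| <= M.
Proof.
move=> mf fM; apply: le_trans (le_normr_Rintegral _ _) _ => //.
  exact: bounded_integrable fM.
have -> : M = \int[mu]_x (fun=> M) x.
  rewrite Rintegral_cst// -[LHS]mulr1; congr (_ * _).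
  exact/esym/(congr1 fine (probability_setT mu)).
apply: le_Rintegral => //.
- apply: (@bounded_integrable R _ _ mu _ M) => //.
    exact: measurableT_comp.
  by move=> x; rewrite normr_id.
- apply: (@bounded_integrable R _ _ mu _ `|M|) => //.
Qed.

Lemma reg_prob_cvg (F : set_system (reg_prob R Y)) (mu : reg_prob R Y) :
  Filter F ->
  (forall f : Y -> R, continuous f ->
     (fun m : reg_prob R Y => \int[val m]_x f x) @ F --> \int[val mu]_x f x) ->
  F --> mu.
Proof.
move=> FF Ff; apply: initial_cvg.
have [_] := ptws_cvgP (integrals mu) (fmap_filter (@integrals R Y) FF); apply.
by move=> f; apply: Ff; exact: set_mem (valP f).
Qed.

Lemma integral_weak_continuous (f : Y -> R) : continuous f ->
  continuous (fun m : reg_prob R Y => \int[val m]_x f x).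
Proof.
move=> cf mu; pose f' : cont_fun R Y := SigSub (mem_set (A := cont_fun R Y) cf).
have cint : continuous
    (@integrals R Y : reg_prob R Y -> {ptws cont_fun R Y -> R}).
  exact: (@initial_continuous (reg_prob R Y) _ (@integrals R Y)).
exact: cvg_comp (cint mu) (@proj_ptws_continuous _ R f' (integrals mu)).
Qed.

(** Along an ultrafilter of measures the integrals of each continuous function
    converge; the limits form a positive functional, and the measure that
    represents it is the limit of the ultrafilter. *)
Theorem reg_prob_compact : compact [set: reg_prob R Y].
Proof.
rewrite compact_ultra => F FU _; have FP : ProperFilter F := ultra_proper.
pose Lam (f : Y -> R) :=
  ultralimit F (fun m : reg_prob R Y => \int[val m]_x f x).
have intM (f : Y -> R) M : continuous f -> (forall x, `|f x| <= M) ->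
    forall m : reg_prob R Y, `|\int[val m]_x f x| <= M.
  move=> cf fM m.
  exact: (@Rintegral_bound _ (borel Y) (val m) f M (continuous_borel cf)).
have LamP (f : Y -> R) : continuous f ->
    (fun m : reg_prob R Y => \int[val m]_x f x) @ F --> Lam f.
  move=> cf; have [M M0 fM] := continuous_bounded_compact cY cf.
  exact: ultralimit_cvg (intM f M cf fM).
have HLam : positive_functional Lam.
  split.
  - move=> f g cf cg; apply: ultralimitP.
    rewrite (_ : (fun m : reg_prob R Y => _) = (fun m : reg_prob R Y =>
        \int[val m]_x f x + \int[val m]_x g x)).
      by apply: cvgD; [exact: LamP | exact: LamP].
    by apply/funext => m; apply: RintegralD => //; exact: continuous_integrable.
  - move=> c f cf; apply: ultralimitP.
    rewrite (_ : (fun m : reg_prob R Y => _) = (fun m : reg_prob R Y =>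
        c * \int[val m]_x f x)).
      by apply: cvgM; [exact: cvg_cst | exact: LamP].
    apply/funext => m; apply: RintegralZl => //.
    exact: continuous_integrable.
  - move=> f cf f0; apply: (limr_ge (cvgP _ (LamP f cf))).
    by apply: (@filterE _ F) => m; exact: Rintegral_ge0.
  - rewrite -[RHS](ultralimit_cst (F := F)); congr ultralimit.
    apply/funext => m; rewrite Rintegral_cst// mul1r.
    exact: (congr1 fine (probability_setT (val m))).
have [mu muE] := riesz_markov hY cY HLam.
exists mu; split => //; apply: reg_prob_cvg => f cf.
by rewrite muE//; exact: LamP.
Qed.

End RegularMeasures.

(** * Lifting measures along a continuous surjection *)

Section Lifting.
Variables (R : realType) (Y Z : ptopologicalType) (r : Y -> Z).
Hypotheses (hY : hausdorff_space Y) (cY : compact [set: Y]).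
Hypotheses (hZ : hausdorff_space Z) (cZ : compact [set: Z]).
Hypothesis cr : continuous r.

Lemma continuous_borel_map :
  measurable_fun [set: borel Y] (r : borel Y -> borel Z).
Proof.
apply: (@measurability _ _ (borel Y) (borel Z) setT r (@open Z) erefl).
move=> _ [V oV <-].
by rewrite setTI; apply: open_borel; apply: open_comp => //.
Qed.

Lemma preimage_borel (B : set (borel Z)) : measurable B ->
  measurable (r @^-1` B : set (borel Y)).
Proof.
by move=> mB; rewrite -[X in measurable X]setTI; exact: continuous_borel_map.
Qed.

Lemma comp_continuous (G : Z -> R) :
  continuous G -> continuous (fun y => G (r y)).
Proof. by move=> cG y; apply: (cvg_comp _ _ (cr (x := y)) (cG (r y))). Qed.

Lemma pushforward_probability (mu : probability (borel Y) R) :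
  exists pi : probability (borel Z) R, forall B, pi B = mu (r @^-1` B).
Proof.
pose p (B : set (borel Z)) := mu (r @^-1` B).
have p0 : p set0 = 0%E by rewrite /p preimage_set0 measure0.
have p_ge0 B : (0 <= p B)%E by rewrite /p measure_ge0.
have p_add : semi_sigma_additive p.
  move=> F mF tF mUF; rewrite /p preimage_bigcup.
  apply: measure_semi_sigma_additive.
  - by move=> n; exact: preimage_borel.
  - apply/trivIsetP => /= i j _ _ ij; rewrite -preimage_setI.
    by move/trivIsetP : tF => /(_ _ _ _ _ ij) ->//; rewrite preimage_set0.
  - by rewrite -preimage_bigcup; exact: preimage_borel.
have pT : p setT = 1%E by rewrite /p preimage_setT probability_setT.
pose m : {measure set (borel Z) -> \bar R} := HB.pack p
  (isMeasure.Build _ (borel Z) R p p0 p_ge0 p_add).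
pose m' : probability (borel Z) R := HB.pack (Measure.sort m)
  (Measure_isProbability.Build _ (borel Z) R m pT).
by exists m'.
Qed.

(** If a compact [K] approximates the preimage of the complement of [B] from
    inside, then the complement of the compact image of [K] is an open set that
    approximates [B] from outside. *)
Lemma pushforward_regular (mu : probability (borel Y) R) :
  regular_measure mu ->
  exists2 pi : probability (borel Z) R, regular_measure pi &
    forall B, pi B = mu (r @^-1` B).
Proof.
move=> rmu; have [pi piE] := pushforward_probability mu.
exists pi => //; apply: regular_approx => // B mB e e0.
have mrB := preimage_borel mB.
have [K [cK KB muK]] := regular_inner cY rmu (measurableC mrB) e0.
have crK : compact (r @` K).
  by apply: continuous_compact cK; exact: continuous_subspaceT.
have clrK : closed (r @` K) by exact: compact_closed_space crK.
have clK := compact_closed_space hY cK.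
exists (~` (r @` K)); split.
- exact: closed_openC.
- by move=> z Bz [y Ky yz]; apply: (KB _ Ky); rewrite /= yz.
have mW : measurable (r @^-1` (~` (r @` K)) : set (borel Y)).
  by apply: preimage_borel; apply: open_borel; exact: closed_openC.
have le1 : (mu (r @^-1` (~` (r @` K))) <= mu (~` K))%E.
  apply: le_measure; rewrite ?inE//.
    by apply: measurableC; exact: closed_borel.
  by move=> y /= nKy Ky; apply: nKy; exists y.
rewrite !piE; apply: le_trans le1 _; move: muK.
rewrite !probability_setC//; last exact: closed_borel.
rewrite -(probability_fineK mu (closed_borel clK)) -(probability_fineK mu mrB).
by rewrite -!EFinB -!EFinD !lee_fin; lra.
Qed.

Lemma pushes_toP (mu : reg_prob R Y) (nu : reg_prob R Z) :
  pushes_to r mu nu <->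
  forall G : Z -> R, continuous G ->
    \int[val mu]_y G (r y) = \int[val nu]_z G z.
Proof.
have [pi rpi piE] := pushforward_regular (reg_probP mu).
have piI (G : Z -> R) : continuous G ->
    \int[pi]_z G z = \int[val mu]_y G (r y).
  move=> cG; rewrite /Rintegral; congr fine.
  have mG : measurable_fun [set: borel Z] (EFin \o G).
    by apply/measurable_EFinP; exact: continuous_borel.
  have iGr : (val mu).-integrable (r @^-1` [set: borel Z]) ((EFin \o G) \o r).
    rewrite preimage_setT; apply: continuous_integrable => //.
    exact: comp_continuous.
  have := @integral_pushforward _ _ (borel Y) (borel Z) R r
    continuous_borel_map (val mu) setT (EFin \o G) mG iGr measurableT.
  rewrite preimage_setT => <-; set pm := (X in _ = integral X _ _).
  have pipm (A : set (borel Z)) : measurable A -> A `<=` setT -> pi A = pm A.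
    by move=> mA _; exact: piE.
  have piI := @eq_measure_integral _ _ _ setT pm pi (EFin \o G) pipm.
  exact: (piI continuous_borel_map).
split=> [munu G cG|munu B mB].
  rewrite -piI// /Rintegral; congr fine.
  apply: eq_measure_integral => A mA _.
  by have := munu _ mA; rewrite /pushforward -piE.
rewrite /pushforward -piE.
apply: (regular_eq_of_integrals hZ cZ rpi (reg_probP nu)) => // G cG.
by rewrite piI// munu.
Qed.

(** By [pushes_toP] the lifts are cut out by equations between weak-* continuous
    functions. *)
Lemma lift_compact (nu : reg_prob R Z) :
  compact [set mu : reg_prob R Y | pushes_to r mu nu].
Proof.
rewrite (_ : [set mu | _] = \bigcap_(G in [set G : Z -> R | continuous G])
   [set mu : reg_prob R Y | \int[val mu]_y G (r y) = \int[val nu]_z G z]).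
  apply: subclosed_compact (reg_prob_compact hY cY) (@subsetT _ _).
  apply: closed_bigI => G /= cG.
  apply: (@closed_comp _ _ (fun mu : reg_prob R Y => \int[val mu]_y G (r y))
     [set x | x = \int[val nu]_z G z]); last exact: closed_eq.
  by move=> mu _; exact: (integral_weak_continuous (comp_continuous cG)).
apply/seteqP; split => mu /=.
  by move/pushes_toP => munu G; exact: munu.
by move=> munu; apply/pushes_toP => G cG; exact: munu.
Qed.

(** The code [c z] lists the integer parts of [g z / e] for [g] in [gs]; taking
    values in a countable type, it cuts [Z] into countably many Borel pieces on
    which every [g] in [gs] oscillates by at most [e]. *)
Lemma countable_partition (gs : seq (Z -> R)) (e : R) : 0 < e ->
  (forall g, List.In g gs -> continuous g) ->
  exists c : Z -> seq int,
    (forall v, measurable ([set z | c z = v] : set (borel Z))) /\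
    forall z z', c z = c z' -> forall g, List.In g gs -> `|g z - g z'| <= e.
Proof.
move=> e0; elim: gs => [_|g gs IH gsc].
  exists (fun=> [::]); split => // -[|k v].
    by rewrite (_ : mkset _ = setT)//; apply/seteqP; split.
  by rewrite (_ : mkset _ = set0)//; apply/seteqP; split.
have [c [cm cP]] := IH (fun h hgs => gsc h (or_intror hgs)).
have cg : continuous g by apply: gsc; left.
have ch : continuous (fun z => g z / e).
  by move=> z; apply: cvgM; [exact: cg | exact: cvg_cst].
exists (fun z => Num.floor (g z / e) :: c z); split.
  case=> [|k v]; first by rewrite (_ : mkset _ = set0)//; apply/seteqP; split.
  rewrite (_ : mkset _ = [set z | g z / e \in `[k%:~R, (k + 1)%:~R[ ]
      `&` [set z | c z = v]).
    apply: measurableI => //; rewrite -[X in measurable X]setTI.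
    exact: (continuous_borel ch measurableT
      (measurable_itv `[k%:~R, (k + 1)%:~R[)).
  apply/seteqP; split => z /=; rewrite in_itv /=.
    by case=> <- <-; rewrite floor_itv.
  by case=> /floor_def -> ->.
move=> z z' [fE cE] h [<-|hgs]; last exact: cP hgs.
have := floor_itv (g z / e); have := floor_itv (g z' / e).
rewrite fE intrD; set k := (Num.floor _)%:~R.
rewrite !ler_pdivlMr// !ltr_pdivrMr// => /andP[a1 a2] /andP[b1 b2].
by rewrite ler_norml; apply/andP; split; lra.
Qed.

(** Send each piece of the partition to one of its points. As there are countably
    many pieces, preimages of arbitrary sets are Borel; hence any map whatsoever
    may be composed with [c] without losing measurability. *)
Lemma countable_valued_approximation (gs : seq (Z -> R)) (e : R) : 0 < e ->
  (forall g, List.In g gs -> continuous g) ->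
  exists c : Z -> Z,
    (forall A : set Z, measurable (c @^-1` A : set (borel Z))) /\
    forall z g, List.In g gs -> `|g (c z) - g z| <= e.
Proof.
move=> e0 gsc; have [k [km kP]] := countable_partition e0 gsc.
pose rep v : Z := xget point [set z | k z = v].
have repE z : k (rep (k z)) = k z.
  exact: (xgetPex point (ex_intro (fun x => k x = k z) z erefl)).
exists (fun z => rep (k z)); split; last by move=> z g; apply: kP; exact: repE.
move=> A; rewrite (_ : _ @^-1` A =
    \bigcup_v (if `[< A (rep v) >] then [set z | k z = v] else set0)).
  apply: countable_bigcupT_measurable; first exact: countableP.
  by move=> v; case: ifP.
apply/seteqP; split => z /= => [Az|[v _]].
  by exists (k z) => //=; case: asboolP.
by case: asboolP => //= Av ->.
Qed.

Hypothesis sr : forall z, exists y, r y = z.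

(** A section [s] of [r] is in general not measurable, but [s \o c] is, for the
    map [c] of [countable_valued_approximation]. Integrating [f \o s \o c]
    against [nu] is a positive functional on [Y]; its value at [g \o r] is the
    integral of [g \o c], which differs from that of [g] by at most [e]. *)
Lemma approximate_lift (nu : reg_prob R Z) (gs : seq (Z -> R)) (e : R) :
  0 < e ->
  (forall g, List.In g gs -> continuous g) ->
  exists mu : reg_prob R Y, forall g, List.In g gs ->
    `|\int[val mu]_y g (r y) - \int[val nu]_z g z| <= e.
Proof.
move=> e0 gsc; have [c [mc cP]] := countable_valued_approximation e0 gsc.
pose s z := projT1 (cid (sr z)); have sK z : r (s z) = z := projT2 (cid (sr z)).
pose Lam (f : Y -> R) := \int[val nu]_z f (s (c z)).
have mf (f : Y -> R) : measurable_fun [set: borel Z] (fun z => f (s (c z))).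
  by move=> _ B _; rewrite setTI; exact: (mc ((fun z => f (s z)) @^-1` B)).
have intf (f : Y -> R) : continuous f ->
    (val nu).-integrable [set: borel Z] (EFin \o (fun z => f (s (c z)))).
  move=> cf; have [M M0 fM] := continuous_bounded_compact cY cf.
  exact: bounded_integrable (mf f) (fun z => fM (s (c z))).
have HLam : positive_functional Lam.
  split.
  - by move=> f g cf cg; apply: RintegralD => //; exact: intf.
  - by move=> a f cf; apply: RintegralZl => //; exact: intf.
  - by move=> f cf f0; exact: Rintegral_ge0.
  - rewrite /Lam Rintegral_cst// mul1r.
    exact: (congr1 fine (probability_setT (val nu))).
have [mu muE] := riesz_markov hY cY HLam.
exists mu => g gsg; have cg := gsc g gsg.
rewrite muE; last exact: comp_continuous.
have ig : (val nu).-integrable [set: borel Z] (EFin \o g).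
  exact: continuous_integrable.
rewrite /Lam -RintegralB//; last first.
  by apply: (intf (fun y => g (r y))); exact: comp_continuous.
apply: Rintegral_bound => /=; last by move=> z; rewrite sK; exact: cP.
apply: measurable_funB; first exact: (mf (fun y => g (r y))).
exact: continuous_borel.
Qed.

(** The sets of approximate lifts, for finite lists of test functions and positive
    tolerances, generate a proper filter; by weak-* compactness it has a cluster
    point, which satisfies every equation exactly. *)
Theorem lift_exists (nu : reg_prob R Z) :
  exists mu : reg_prob R Y, pushes_to r mu nu.
Proof.
pose D := [set p : seq (Z -> R) * R |
  (forall g, List.In g p.1 -> continuous g) /\ 0 < p.2].
pose W (p : seq (Z -> R) * R) := [set mu : reg_prob R Y |
  forall g, List.In g p.1 ->
    `|\int[val mu]_y g (r y) - \int[val nu]_z g z| <= p.2].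
have FF : ProperFilter (filter_from D W).
  apply: filter_from_proper => [|[gs e] [gsc e0]]; last first.
    by have [mu muP] := approximate_lift nu e0 gsc; exists mu.
  apply: filter_from_filter; first by exists ([::], 1); split => //=.
  move=> [gs e] [hs d] [gsc e0] [hsc d0] /=.
  exists ((gs ++ hs)%list, Num.min e d) => /=.
    split; last by rewrite lt_min e0.
    move=> g gP; have [ggs|ghs] := List.in_app_or gs hs g gP.
      exact: gsc.
    exact: hsc.
  move=> mu muP; split => g gP /=.
    apply: le_trans (muP g _) _; last by rewrite ge_min lexx.
    by apply: List.in_or_app; left.
  apply: le_trans (muP g _) _; last by rewrite ge_min lexx orbT.
  by apply: List.in_or_app; right.
have [mu [_ clmu]] := reg_prob_compact hY cY FF (@filterT _ _ _).
exists mu; apply/pushes_toP => G cG.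
apply/eqP; rewrite -subr_eq0 -normr_le0; apply/ler_addgt0Pr => e e0.
have e2 : 0 < e / 2 by rewrite divr_gt0.
have WF : filter_from D W (W ([:: G], e / 2)).
  by exists ([:: G], e / 2) => //=; split => //= g [<-|[]].
have nmu : nbhs mu [set m : reg_prob R Y |
    `|\int[val mu]_y G (r y) - \int[val m]_y G (r y)| < e / 2].
  have cGr := integral_weak_continuous (comp_continuous cG).
  exact: ((cvgrPdist_lt _ _).1 (cGr mu) _ e2).
have [m [/= mW md]] := clmu _ _ WF nmu.
have := mW G (or_introl erefl); rewrite add0r => mG.
apply: le_trans (ler_distD (\int[val m]_y G (r y)) _ _) _.
by rewrite [leRHS](splitr e); apply: lerD => //; exact: ltW.
Qed.

Lemma mixture_probability (mu1 mu2 : probability (borel Y) R) (t : R) :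
  0 <= t <= 1 -> exists m : probability (borel Y) R,
    forall B, m B = (t%:E * mu1 B + (1 - t)%:E * mu2 B)%E.
Proof.
move=> /andP[t0 t1]; have s0 : 0 <= 1 - t by rewrite subr_ge0.
pose p (B : set (borel Y)) := (t%:E * mu1 B + (1 - t)%:E * mu2 B)%E.
have pE : p = measure_add (mscale (NngNum t0) mu1) (mscale (NngNum s0) mu2).
  by apply/funext => B; rewrite measure_addE.
have p0 : p set0 = 0%E by rewrite /p !measure0 !mule0 adde0.
have p_ge0 B : (0 <= p B)%E by rewrite adde_ge0// mule_ge0// lee_fin.
have p_add : semi_sigma_additive p.
  by rewrite pE; exact: measure_semi_sigma_additive.
have pT : p setT = 1%E by rewrite /p !probability_setT !mule1 -EFinD subrKC.
clear pE; pose m : {measure set (borel Y) -> \bar R} := HB.pack p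
  (isMeasure.Build _ (borel Y) R p p0 p_ge0 p_add).
pose m' : probability (borel Y) R := HB.pack (Measure.sort m)
  (Measure_isProbability.Build _ (borel Y) R m pT).
by exists m'.
Qed.

Lemma lift_convex (nu : reg_prob R Z) :
  convex_measures [set mu : reg_prob R Y | pushes_to r mu nu].
Proof.
move=> mu1 mu2 l1 l2 t t01; have /andP[t0 t1] := t01.
have [m mE] := mixture_probability (val mu1) (val mu2) t01.
have rm : regular_measure m.
  apply: regular_approx => // B mB e e0.
  have [V1 [oV1 BV1 V1e]] := regular_outer (reg_probP mu1) mB e0.
  have [V2 [oV2 BV2 V2e]] := regular_outer (reg_probP mu2) mB e0.
  have oV : open (V1 `&` V2) by exact: openI.
  exists (V1 `&` V2); split => //; first by rewrite subsetI.
  have h1 : (val mu1 (V1 `&` V2) <= val mu1 V1)%E.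
    by apply: le_measure; rewrite ?inE//; exact: open_borel.
  have h2 : (val mu2 (V1 `&` V2) <= val mu2 V2)%E.
    by apply: le_measure; rewrite ?inE//; exact: open_borel.
  rewrite !mE.
  have {h1 V1e} := le_trans h1 V1e; have {h2 V2e} := le_trans h2 V2e.
  rewrite -(probability_fineK (val mu1) (open_borel oV)).
  rewrite -(probability_fineK (val mu2) (open_borel oV)).
  rewrite -(probability_fineK (val mu1) mB) -(probability_fineK (val mu2) mB).
  rewrite -!EFinM -!EFinD !lee_fin => h2 h1; nra.
have rm' : `[< regular_measure m >] by exact/asboolP.
exists (exist _ m rm'); last by move=> B _; exact: mE.
move=> B mB; rewrite /pushforward.
rewrite [LHS]mE.
have -> : val mu1 (r @^-1` B) = val nu B by exact: l1.
have -> : val mu2 (r @^-1` B) = val nu B by exact: l2.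
by rewrite -(probability_fineK (val nu) mB) -!EFinM -EFinD; congr (_%:E); lra.
Qed.

End Lifting.

(** * Lifts of the representing measure to the space of complete types *)

Theorem corollary4p13 (R : realType) (X : topologicalType)
    (B : brelot_space R X) (D : martin_setting B)
    (HD : martin_assumptions D)
    (metrizable_H1 : metrizable_set R (H1 D))
    (simplex_H1 : choquet_simplex (H1 D))
    (q : {ptws params D -> R}) (Hq : H1 D q)
    (nu_q : reg_prob R (Sphi D)) (Hnu : unique_representing q nu_q) :
  [/\ exists mu : reg_prob R (S1 D), pushes_to (r_phi D) mu nu_q,
      forall mu : reg_prob R (S1 D),
        pushes_to (r_phi D) mu nu_q <->
        (forall F : Sphi D -> R, continuous F ->
           (\int[val mu]_p F (r_phi D p) = \int[val nu_q]_p F p)%R),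
      Lift nu_q !=set0,
      compact (Lift nu_q) &
      convex_measures (Lift nu_q)].
Proof.
have hS1 : hausdorff_space (S1 D) by exact: type_space_hausdorff.
have cS1 : compact [set: S1 D] by exact: type_space_compact.
have hSphi : hausdorff_space (Sphi D) by exact: type_space_hausdorff.
have cSphi : compact [set: Sphi D] by exact: type_space_compact.
have cr : continuous (r_phi D) by exact: restrict_type_continuous.
have sr p : exists p', r_phi D p' = p by exact: restrict_type_surjective.
have lift := lift_exists hS1 cS1 hSphi cSphi cr sr nu_q.
split.
- exact: lift.
- by move=> mu; exact: pushes_toP.
- exact: lift.
- exact: lift_compact.
- exact: lift_convex.
Qed.
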